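(* Let $\beta>0$, $M>0$ and $$\mathcal{H}(\beta,M)=\left\{f=\sum_{l\ge0,\,0\le k\le2^l-1}f_{lk}\psi_{lk}:\ \sup_{l\ge0,\,0\le k\le2^l-1}2^{l(1/2+\beta)}|f_{lk}|\le M\right\}.$$ Let $0\le\epsilon<1/4$, let $n\ge2$, and let $\{Y_{t,1}\}_{t\in[0,1]},\dots,\{Y_{t,n}\}_{t\in[0,1]}$ be i.i.d. processes from $(1-\epsilon)P_f+\epsilon Q$, where $P_f$ is the law of the process $dY_t=f(t)\,dt+dW_t$, $t\in[0,1]$, with $W$ a standard Wiener process. Let $L$ be the largest integer such that $2^L\le\left(\frac{\log n}{n}\vee\epsilon^2\right)^{-\frac{1}{2\beta+1}}$, and define $$\hat f=\sum_{0\le l\le L,\,0\le k\le2^l-1}\hat f_{lk}\psi_{lk},\qquad \hat f_{lk}=\mathrm{Median}\left(\{y_{lk,i}\}_{i=1}^n\right),\qquad y_{lk,i}=\int_0^1\psi_{lk}(t)\,dY_{t,i}.$$ Then there are constants $C,C'>0$ such that $$\|\hat f-f\|_\infty^2\le C\left[\left(\frac{n}{\log n}\right)^{-\frac{2\beta}{2\beta+1}}\vee\epsilon^{\frac{4\beta}{2\beta+1}}\right]$$ with $\mathbb{P}_{(\epsilon,f,Q)}$-probability at least $1-\exp\left(-C'\left(\log n+n\epsilon^2\right)\right)$, uniformly over $f\in\mathcal{H}(\beta,M)$ and all probability distributions $Q$.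
   Context: $\{\psi_{lk}\}_{l\ge0,0\le k\le2^l-1}$ is an orthonormal wavelet basis of $L^2[0,1]$ (the Cohen–Daubechies–Vial construction of wavelets on the interval). $\mathbb{P}_{(\epsilon,f,Q)}$ is the law under which the $n$ observed processes are i.i.d. from $(1-\epsilon)P_f+\epsilon Q$. Equivalently, each observation may be identified with its sequence of wavelet coefficients $(y_{lk})_{l\ge0,0\le k\le2^l-1}$; under $P_f$ one has $y_{lk}=f_{lk}+z_{lk}$ with $z_{lk}$ i.i.d. $N(0,1)$, and $Q$ is then an arbitrary law of such a sequence. $a\vee b=\max(a,b)$; $\|\cdot\|_\infty$ is the supremum norm on $[0,1]$. The constants $C,C'$ do not depend on $n,\epsilon,f,Q$ (they may depend on $\beta$, $M$ and the basis). *)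

(* Defs.v *)
From HB Require Import structures.
From mathcomp Require Import all_boot all_order all_algebra.
From mathcomp Require Import all_classical all_reals all_analysis.

Set Implicit Arguments.
Unset Strict Implicit.
Unset Printing Implicit Defensive.

Import Order.TTheory GRing.Theory Num.Theory.
Import numFieldNormedType.Exports.

Local Open Scope classical_set_scope.
Local Open Scope ring_scope.

(* The index set {(l, k) : l >= 0, 0 <= k <= 2^l - 1}. *)
Definition widx : Type := {l : nat & 'I_(2 ^ l)}.
Definition ix (l : nat) (k : 'I_(2 ^ l)) : widx := Tagged (fun l => 'I_(2 ^ l)) k.

Section Wavelets.
Context {R : realType}.
Implicit Types (f g u : R -> R) (psi : widx -> R -> R).

Definition I01 : set R := `[0, 1].

Definition inner01 f g : R :=
  \int[lebesgue_measure]_(x in I01) (f x * g x).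

Definition sup01 g : \bar R := ereal_sup [set `|g x|%:E | x in I01].

Record orthonormal_basis01 psi : Prop := OrthonormalBasis01 {
  onb_measurable : forall a, measurable_fun I01 (psi a) ;
  onb_orthonormal : forall a b, inner01 (psi a) (psi b) = (a == b)%:R ;
  onb_complete : forall g, measurable_fun I01 g ->
    lebesgue_measure.-integrable I01 (fun x => ((g x) ^+ 2)%:E) ->
    (forall a, inner01 g (psi a) = 0) ->
    {ae lebesgue_measure, forall x, x \in I01 -> g x = 0} }.

(* Daubechies' scaling function and wavelet with N vanishing moments and
   filter h_0, ..., h_(2N-1), both supported in [0, 2N-1]; the functions of
   Cohen, Daubechies and Vial, supported in [-N+1, N], are x |-> phi (x+N-1)
   and x |-> psi0 (x+N-1).  N = 1 is the Haar case. *)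
Record daubechies (N : nat) (h : nat -> R) (phi psi0 : R -> R) : Prop :=
  Daubechies {
  daub_N : (0 < N)%N ;
  daub_measurable : measurable_fun setT phi ;
  daub_bounded : exists B : R, forall x, `|phi x| <= B ;
  daub_support : forall x, ~~ (0 <= x <= (2 * N).-1%:R) -> phi x = 0 ;
  daub_mass : \int[lebesgue_measure]_(x in [set: R]) phi x = 1 ;
  daub_refinement : forall x,
    phi x = Num.sqrt 2 * \sum_(k < 2 * N) h k * phi (2 * x - k%:R) ;
  daub_orthonormal : forall z : int,
    \int[lebesgue_measure]_(x in [set: R]) (phi x * phi (x - z%:~R))
    = (z == 0)%:R ;
  daub_wavelet : forall x,
    psi0 x = Num.sqrt 2 *
      \sum_(k < 2 * N) (-1) ^+ k * h ((2 * N).-1 - k)%N * phi (2 * x - k%:R) ;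
  daub_moments : forall m : nat, (m < N)%N ->
    \int[lebesgue_measure]_(x in [set: R]) (x ^+ m * psi0 x) = 0 }.

(* Edge functions are placed with the endpoint at 0: the left ones live on
   [0, +oo), the right ones on (-oo, 0].  The edge scaling functions are
   combinations of the truncated sums \sum_i 'C(i, n) phi(. + i), n < N, over
   the translates of phi that meet the edge, so that polynomials of degree < N
   are reproduced up to the endpoint. *)
Definition left_scaling (N : nat) (phi u : R -> R) : Prop :=
  exists a : nat -> R, forall x,
    u x = if 0 <= x then \sum_(n < N) a n *
            \sum_(i < (2 * N).-1) 'C(i, n)%:R * phi (x + i%:R)
          else 0.

Definition right_scaling (N : nat) (phi u : R -> R) : Prop :=
  exists a : nat -> R, forall x,
    u x = if x <= 0 then \sum_(n < N) a n *
            \sum_(i < (2 * N).-1) 'C(i, n)%:R * phi (x + ((2 * N).-1 - i)%:R)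
          else 0.

(* The edge wavelets are combinations of the scaling functions of the next
   finer resolution near the edge; orthogonality to the coarser resolution is
   part of [orthonormal_basis01]. *)
Definition left_wavelet (N : nat) (phi : R -> R) (phiL : nat -> R -> R) u :
    Prop :=
  exists a b : nat -> R, forall x,
    u x = Num.sqrt 2 *
      (\sum_(i < N) a i * phiL i (2 * x) +
       \sum_(r < (2 * N).-1) b r * phi (2 * x - r.+1%:R)).

Definition right_wavelet (N : nat) (phi : R -> R) (phiR : nat -> R -> R) u :
    Prop :=
  exists a b : nat -> R, forall x,
    u x = Num.sqrt 2 *
      (\sum_(i < N) a i * phiR i (2 * x) +
       \sum_(r < (2 * N).-1) b r * phi (2 * x + (2 * N + r)%:R)).

(* The m-th function (m < 2^j) at resolution j: N left edge functions,
   2^j - 2N interior ones and N right edge functions, where [g (. - s)] has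
   support in [s, s + 2N - 1] and s runs over 1, ..., 2^j - 2N. *)
Definition dilate (N : nat) g (gL gR : nat -> R -> R) (j m : nat) (x : R) : R :=
  Num.sqrt (2 ^+ j) *
  (if (m < N)%N then gL m (2 ^+ j * x)
   else if (m < 2 ^ j - N)%N then g (2 ^+ j * x - (m - N).+1%:R)
   else gR ((2 ^ j).-1 - m)%N (2 ^+ j * (x - 1))).

(* The Cohen-Daubechies-Vial system consists of the 2^J scaling functions of
   some coarsest resolution J, 2N <= 2^J, and of the 2^j wavelets of every
   resolution j >= J.  This is one function too many for labelling all of
   them by (l, k), k < 2^l, with l equal to the resolution, so the label
   l is allowed to differ from the resolution by at most a constant c.
   Together with [orthonormal_basis01], psi is then a relabelling of the
   whole system. *)
Definition cdv_wavelets psi : Prop :=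
  exists (N J c : nat) (h : nat -> R) (phi psi0 : R -> R)
         (phiL phiR psiL psiR : nat -> R -> R),
  [/\ daubechies N h phi psi0,
      forall n, (n < N)%N ->
        [/\ left_scaling N phi (phiL n), right_scaling N phi (phiR n),
            left_wavelet N phi phiL (psiL n) &
            right_wavelet N phi phiR (psiR n)],
      (2 * N <= 2 ^ J)%N &
      forall l (k : 'I_(2 ^ l)), exists j m : nat,
        [/\ (j <= l + c)%N, (l <= j + c)%N, (m < 2 ^ j)%N &
         (j = J /\
            forall x, 0 <= x <= 1 ->
              psi (ix k) x = dilate N phi phiL phiR j m x) \/
         ((J <= j)%N /\
            forall x, 0 <= x <= 1 ->
              psi (ix k) x = dilate N psi0 psiL psiR j m x)]].

(* f = \sum_(l, k) f_lk psi_lk is read pointwise on [0, 1], with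
   f_lk = <f, psi_lk>: the series converges uniformly under the coefficient
   bound, and its sum is the version of f used in the supremum norm. *)
Definition wavelet_ball psi (beta M : R) : set (R -> R) :=
  [set f |
    (forall l (k : 'I_(2 ^ l)),
       2 `^ (l%:R * (1 / 2 + beta)) * `|inner01 f (psi (ix k))| <= M) /\
    (forall x, 0 <= x <= 1 ->
       (fun m : nat => \sum_(l < m) \sum_(k < 2 ^ l)
          inner01 f (psi (ix k)) * psi (ix k) x) @ \oo --> f x)].

End Wavelets.

(* An observation is its sequence of wavelet coefficients; the space of such
   sequences carries the sigma-algebra generated by the coordinates. *)
Definition coordinate_cylinders (R : realType) : set (set (widx -> R)) :=
  [set E | exists (a : widx) (B : set R),
     measurable B /\ E = [set y | B (y a)]].

Definition wseq (R : realType) : measurableType _ :=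
  g_sigma_algebraType (@coordinate_cylinders R).

(* P_f: the coordinates y_lk are independent N(f_lk, 1). *)
Definition signal_law (R : realType) (psi : widx -> R -> R) (f : R -> R)
    (Pf : probability (wseq R) R) : Prop :=
  forall (s : seq widx) (B : widx -> set R), uniq s ->
    (forall a, measurable (B a)) ->
    Pf [set y | forall a, a \in s -> B a (y a)] =
    (\prod_(a <- s) normal_prob (inner01 f (psi a)) 1 (B a))%E.

Definition contaminate (R : realType) (eps : R) (Pf Q : probability (wseq R) R)
    (A : set (wseq R)) : \bar R :=
  ((1 - eps)%:E * Pf A + eps%:E * Q A)%E.

Definition iid_sample (R : realType) (d : measure_display)
    (T : measurableType d) (P : probability T R) (n : nat)
    (law : set (wseq R) -> \bar R) (Y : 'I_n -> T -> wseq R) : Prop :=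
  (forall i, measurable_fun setT (Y i)) /\
  (forall A : 'I_n -> set (wseq R), (forall i, measurable (A i)) ->
     P [set w | forall i, A i (Y i w)] = (\prod_(i < n) law (A i))%E).

(* Mean of the two middle order statistics, which coincide for odd size. *)
Definition median (R : realType) (s : seq R) : R :=
  let t := sort <=%R s in
  (nth 0 t (size s).-1./2 + nth 0 t (size s)./2) / 2.

Definition fhat (R : realType) (psi : widx -> R -> R) (n L : nat)
    (y : 'I_n -> wseq R) (x : R) : R :=
  \sum_(l < L.+1) \sum_(k < 2 ^ l)
    median [seq (y i : widx -> R) (ix k) | i <- enum 'I_n] * psi (ix k) x.

Definition is_cutoff (R : realType) (beta eps : R) (n L : nat) : Prop :=
  let X := Num.max (ln n%:R / n%:R) (eps ^+ 2) `^ (- (1 / (2 * beta + 1))) in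
  2 ^+ L <= X /\ (forall m : nat, 2 ^+ m <= X -> (m <= L)%N).

(* Main.v *)
Require Import Defs.
From HB Require Import structures.
From mathcomp Require Import all_boot all_order all_algebra.
From mathcomp Require Import all_classical all_reals all_analysis.
From mathcomp Require Import measurable_realfun zify ring lra.
Set Implicit Arguments.
Unset Strict Implicit.
Unset Printing Implicit Defensive.
Import Order.TTheory GRing.Theory Num.Theory.
Import numFieldNormedType.Exports.
Local Open Scope classical_set_scope.
Local Open Scope ring_scope.

(** Everything rests on two facts: with high probability every median up to
    level L is within a multiple of eps + sqrt (ln n / n) of its coefficient,
    and a sup-norm error is bounded level by level.

    _Medians._ If the median of a coordinate exceeds f_lk + t, at least half of
    the observations do.  One observation exceeds f_lk + t with probability at
    most (1 - eps) G(t) + eps, where G is the Gaussian tail, and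
    G(t) <= 1/2 - c t for t in [0, 1] ([gauss_tail_le]).  Contamination
    therefore costs only a shift of order eps: with t a large multiple of
    r = eps + sqrt (ln n / n) the exceedance probability is at most 1/2 - 2 r,
    and [majority_tail] turns this into a bound exp (- 8 n r ^ 2), which beats
    the number O(n) of coordinates.  This needs t <= 1, so two other regimes
    are treated apart in [medians_concentrate].  If r is bounded below and n is
    large, a fixed t gives a bound exponential in n.  If n is bounded, a union
    bound over the medians is too weak; but all the n observations lie near f
    simultaneously with probability at least (3/8) ^ n, and
    1 - exp (- C' (ln n + n eps ^ 2)) is below this number once C' is small.

    _Sup norm._ The wavelets of level l satisfy
    sum_k |psi_lk| <= B 2 ^ (l/2) on [0, 1] ([cdv_sum_le]).  Errors of size tau
    in the coefficients up to level L thus cost O(tau 2 ^ (L/2)), and the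
    omitted levels cost O(2 ^ (- L beta)), both by geometric series.  The choice
    of L balances the two terms ([rate_variance], [rate_bias]).

    Finally, the error event is an uncountable intersection over x, so that its
    measurability is not automatic; it depends on finitely many medians only,
    through a closed condition ([measurable_forall_affine]). *)

(** * Wavelets of one level *)

Section Waves.
Context {R : realType}.
Implicit Types (g : R -> R) (gL gR : nat -> R -> R).

(** Injectivity of the label [u] bounds the number of nonzero terms by the
    length of the window. *)
Lemma sum_window_le (I : finType) (P : pred I) (u : I -> nat) (F : I -> R)
    (s K : nat) (B : R) :
  {in P &, injective u} -> 0 <= B -> (forall i, P i -> F i <= B) ->
  (forall i, P i -> F i != 0 -> (s <= u i < s + K)%N) ->
  \sum_(i | P i) F i <= B * K%:R.
Proof.
move=> inju B0 FB Fs.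
rewrite (bigID (fun i => F i != 0)) /= [X in _ + X]big1 ?addr0; last first.
  by move=> i /andP[_]; rewrite negbK => /eqP.
pose A := [set i | P i && (F i != 0)]%SET.
apply: (@le_trans _ _ (\sum_(i in A) B)).
  rewrite big_mkcond [leRHS]big_mkcond; apply: ler_sum => i _; rewrite inE.
  by case: ifP => // /andP[Pi _]; exact: FB.
rewrite sumr_const -[B *+ _]mulr_natr ler_wpM2l // ler_nat.
rewrite cardE -(size_map u) -(size_iota s K); apply: uniq_leq_size.
  rewrite map_inj_in_uniq ?enum_uniq// => i j; rewrite !mem_enum !inE.
  by move=> /andP[Pi _] /andP[Pj _]; exact: inju.
move=> _ /mapP[i + ->]; rewrite mem_enum inE mem_iota => /andP[Pi Fi].
exact: Fs.
Qed.

(** All the translates that do not vanish at [y] start within distance [K] of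
    the first of them. *)
Lemma translates_sum_le (I : finType) (P : pred I) (u : I -> nat) g
    (K : nat) (B : R) (y : R) :
  {in P &, injective u} -> (forall x, `|g x| <= B) ->
  (forall x, ~~ (0 <= x <= K%:R) -> g x = 0) ->
  \sum_(i | P i) `|g (y - (u i)%:R)| <= B * K.+1%:R.
Proof.
move=> inju gB g0; have B0 : 0 <= B by exact: le_trans (gB 0).
have [/fintype.existsP[i0 /andP[Pi0 gi0]]|noi] :=
    boolP [exists i, P i && (g (y - (u i)%:R) != 0)].
  case: (@arg_minnP _ i0 (fun i => P i && (g (y - (u i)%:R) != 0)) u).
    by rewrite Pi0.
  move=> i1 /andP[Pi1 gi1] mini1; apply: (@sum_window_le _ _ u _ (u i1)) => //.
  move=> i Pi; rewrite normr_eq0 => gi; rewrite mini1 ?Pi//=.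
  have : 0 <= y - (u i)%:R by apply: contra_neqT gi => yi; rewrite g0 // (negbTE yi).
  have : y - (u i1)%:R <= K%:R.
    by apply: contra_neqT gi1 => yi; rewrite g0 // (negbTE yi) andbF.
  move=> h1 h2; rewrite addnS ltnS -(ler_nat R) natrD; lra.
rewrite big1 ?mulr_ge0// => i Pi; apply/eqP; rewrite normr_eq0.
move: noi; rewrite negb_exists => /fintype.forallP/(_ i); rewrite Pi/= negbK.
exact.
Qed.

Lemma sqrt2X (j : nat) : Num.sqrt (2 ^+ j) = Num.sqrt 2 ^+ j :> R.
Proof.
rewrite -[X in Num.sqrt (X ^+ _)](@sqr_sqrtr _ 2)// -exprM mulnC exprM.
by rewrite sqrtr_sqr ger0_norm// exprn_ge0// sqrtr_ge0.
Qed.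

(** The functions of one resolution are split into the left edge, the interior
    translates and the right edge.  The sum is indexed through an injective
    label because the functions of one resolution may be scattered over several
    levels l of the basis. *)
Lemma dilate_sum_le (I : finType) (P : pred I) (u : I -> nat) g gL gR
    (N K j : nat) (B : R) (x : R) :
  {in P &, injective u} -> (forall i, P i -> (u i < 2 ^ j)%N) ->
  (forall x, `|g x| <= B) -> (forall x, ~~ (0 <= x <= K%:R) -> g x = 0) ->
  (forall m x, (m < N)%N -> `|gL m x| <= B) ->
  (forall m x, (m < N)%N -> `|gR m x| <= B) ->
  \sum_(i | P i) `|dilate N g gL gR j (u i) x| <=
  Num.sqrt 2 ^+ j * (B * (N + K.+1 + N)%:R).
Proof.
move=> inju uj gB g0 gLB gRB; have B0 : 0 <= B by exact: le_trans (gB 0).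
under eq_bigr do rewrite /dilate normrM sqrt2X ger0_norm ?exprn_ge0 ?sqrtr_ge0//.
rewrite -mulr_sumr ler_wpM2l ?exprn_ge0 ?sqrtr_ge0//.
rewrite [leRHS](_ : _ = B * N%:R + (B * K.+1%:R + B * N%:R)); last first.
  by rewrite !natrD; ring.
rewrite (bigID (fun i => u i < N)%N) /=.
apply: lerD.
  apply: (@sum_window_le _ _ u _ 0%N) => //.
  - by move=> i i' /andP[Pi _] /andP[Pi' _]; exact: inju.
  - by move=> i /andP[Pi uN]; rewrite uN gLB.
  - by move=> i /andP[Pi uN] _; rewrite add0n.
rewrite (bigID (fun i => u i < 2 ^ j - N)%N) /=; apply: lerD.
  rewrite (eq_bigr (fun i => `|g (2 ^+ j * x - 1 - (u i - N)%:R)|)); last first.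
    move=> i /andP[/andP[_ /negbTE ->] ->].
    by congr (`|g _|); rewrite -[(u i - N).+1%:R]natr1; ring.
  apply: translates_sum_le => // i i'.
  rewrite !unfold_in -!leqNgt => /andP[/andP[Pi Ni] _] /andP[/andP[Pi' Ni'] _].
  move=> e; apply: inju => //.
  by rewrite -(subnK Ni) -(subnK Ni') e.
apply: (@sum_window_le _ _ u _ (2 ^ j - N)%N) => //.
- by move=> i i' /andP[/andP[Pi _] _] /andP[/andP[Pi' _] _]; exact: inju.
- move=> i /andP[/andP[Pi uN] uj']; rewrite (negbTE uN) (negbTE uj').
  apply: gRB; have := uj _ Pi; move: uN uj'; rewrite -!leqNgt => h1 h2 h3.
  rewrite ltn_subLR; last by rewrite -ltnS prednK ?(leq_ltn_trans _ h3).
  rewrite -(leq_add2r 1) !addn1 prednK ?(leq_ltn_trans _ h3)// ltnS.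
  by rewrite addnC -leq_subLR.
- move=> i /andP[/andP[Pi uN] uj'] _; rewrite leqNgt uj'/=.
  by apply: (leq_trans (uj _ Pi)); rewrite addnC -leq_subLR.
Qed.


Definition sup_bounded (u : R -> R) := exists B : R, forall x, `|u x| <= B.

Lemma sup_bounded_cst (c : R) : sup_bounded (fun=> c).
Proof. by exists `|c|. Qed.

Lemma sup_boundedD u v : sup_bounded u -> sup_bounded v ->
  sup_bounded (fun x => u x + v x).
Proof.
move=> [B uB] [C vC]; exists (B + C) => x.
by rewrite (le_trans (ler_normD _ _))// lerD.
Qed.

Lemma sup_boundedZ (c : R) u : sup_bounded u -> sup_bounded (fun x => c * u x).
Proof. by move=> [B uB]; exists (`|c| * B) => x; rewrite normrM ler_wpM2l. Qed.

Lemma sup_bounded_comp u (v : R -> R) :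
  sup_bounded u -> sup_bounded (fun x => u (v x)).
Proof. by move=> [B uB]; exists B. Qed.

Lemma sup_bounded_if (p : R -> bool) u v : sup_bounded u -> sup_bounded v ->
  sup_bounded (fun x => if p x then u x else v x).
Proof.
move=> [B uB] [C vC]; exists (Num.max B C) => x.
by rewrite le_max; case: ifP; rewrite ?uB ?vC ?orbT.
Qed.

Lemma sup_bounded_sum (I : finType) (u : I -> R -> R) :
  (forall i, sup_bounded (u i)) -> sup_bounded (fun x => \sum_i u i x).
Proof.
move=> ub; have [B uB] : exists B : I -> R, forall i x, `|u i x| <= B i.
  by apply: (@fin_all_exists _ _ (fun i b => forall x, `|u i x| <= b)).
exists (\sum_i B i) => x.
by rewrite (le_trans (ler_norm_sum _ _ _))// ler_sum.
Qed.

Lemma sup_bounded_family (N : nat) (u : nat -> R -> R) :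
  (forall n, (n < N)%N -> sup_bounded (u n)) ->
  exists B : R, forall n x, (n < N)%N -> `|u n x| <= B.
Proof.
elim: N => [|N IH] ub; first by exists 0.
have [B uB] := IH (fun n h => ub n (ltnW h)); have [C uC] := ub N (ltnSn N).
exists (Num.max B C) => n x; rewrite ltnS leq_eqVlt le_max => /orP[/eqP->|nN].
  by rewrite uC orbT.
by rewrite uB.
Qed.

Lemma left_scaling_bounded N phi u :
  sup_bounded phi -> left_scaling N phi u -> sup_bounded u.
Proof.
move=> hphi [a ua]; rewrite (funext ua).
apply: sup_bounded_if; last exact: sup_bounded_cst.
apply: sup_bounded_sum => n; apply/sup_boundedZ/sup_bounded_sum => i.
exact/sup_boundedZ/sup_bounded_comp.
Qed.

Lemma right_scaling_bounded N phi u :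
  sup_bounded phi -> right_scaling N phi u -> sup_bounded u.
Proof.
move=> hphi [a ua]; rewrite (funext ua).
apply: sup_bounded_if; last exact: sup_bounded_cst.
apply: sup_bounded_sum => n; apply/sup_boundedZ/sup_bounded_sum => i.
exact/sup_boundedZ/sup_bounded_comp.
Qed.

Lemma left_wavelet_bounded N phi (phiL : nat -> R -> R) u :
  sup_bounded phi -> (forall n, (n < N)%N -> sup_bounded (phiL n)) ->
  left_wavelet N phi phiL u -> sup_bounded u.
Proof.
move=> hphi hL [a [b ua]]; rewrite (funext ua).
apply/sup_boundedZ/sup_boundedD; apply: sup_bounded_sum => i.
  exact/sup_boundedZ/sup_bounded_comp/hL.
exact/sup_boundedZ/sup_bounded_comp.
Qed.

Lemma right_wavelet_bounded N phi (phiR : nat -> R -> R) u :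
  sup_bounded phi -> (forall n, (n < N)%N -> sup_bounded (phiR n)) ->
  right_wavelet N phi phiR u -> sup_bounded u.
Proof.
move=> hphi hL [a [b ua]]; rewrite (funext ua).
apply/sup_boundedZ/sup_boundedD; apply: sup_bounded_sum => i.
  exact/sup_boundedZ/sup_bounded_comp/hL.
exact/sup_boundedZ/sup_bounded_comp.
Qed.

Lemma daubechies_wavelet_bounded N h (phi psi0 : R -> R) :
  daubechies N h phi psi0 -> sup_bounded psi0.
Proof.
move=> hd; rewrite (funext (daub_wavelet hd)).
apply/sup_boundedZ/sup_bounded_sum => i.
exact/sup_boundedZ/sup_bounded_comp/(daub_bounded hd).
Qed.

Lemma daubechies_wavelet_support N h (phi psi0 : R -> R) x :
  daubechies N h phi psi0 -> ~~ (0 <= x <= (2 * N).-1%:R) -> psi0 x = 0.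
Proof.
move=> hd xN; rewrite (daub_wavelet hd) big1 ?mulr0// => k _.
rewrite (daub_support hd) ?mulr0//; apply: contra xN => /andP[h1 h2].
have N0 := daub_N hd.
have k0 : 0 <= k%:R :> R by [].
have kN : k%:R <= (2 * N).-1%:R :> R by rewrite ler_nat -ltnS prednK// muln_gt0.
by apply/andP; split; lra.
Qed.

(** Two labels of the same function would have scalar product 1. *)
Lemma onb_inj (psi : widx -> R -> R) a b : orthonormal_basis01 psi ->
  (forall x, 0 <= x <= 1 -> psi a x = psi b x) -> a = b.
Proof.
move=> honb ab; have := onb_orthonormal honb a b.
have -> : inner01 (psi a) (psi b) = inner01 (psi a) (psi a).
  apply: eq_Rintegral => x; rewrite inE /I01/= in_itv/= => x01.
  by rewrite ab.
rewrite (onb_orthonormal honb) eqxx; have [//|_] := eqVneq a b.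
by move=> /eqP; rewrite oner_eq0.
Qed.

(** Distinct labels (l, k) name distinct functions of the multiresolution system,
    so each pair (kind, resolution) contributes at most one full sum over its
    translates, and only 2 c + 1 resolutions can occur at level l. *)
Lemma cdv_sum_le (psi : widx -> R -> R) : cdv_wavelets psi -> orthonormal_basis01 psi ->
  exists2 B : R, 0 < B & forall l x, 0 <= x <= 1 ->
    \sum_(k < 2 ^ l) `|psi (ix k) x| <= B * Num.sqrt 2 ^+ l.
Proof.
move=> [N [J [c [h [phi [psi0 [phiL [phiR [psiL [psiR]]]]]]]]]].
move=> [hd hE _ hpsi] honb.
have bphi : sup_bounded phi := daub_bounded hd.
have bphiL n : (n < N)%N -> sup_bounded (phiL n).
  by move=> /hE[hL _ _ _]; exact: left_scaling_bounded hL.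
have bphiR n : (n < N)%N -> sup_bounded (phiR n).
  by move=> /hE[_ hR _ _]; exact: right_scaling_bounded hR.
have bpsiL n : (n < N)%N -> sup_bounded (psiL n).
  by move=> /hE[_ _ hL _]; exact: left_wavelet_bounded hL.
have bpsiR n : (n < N)%N -> sup_bounded (psiR n).
  by move=> /hE[_ _ _ hR]; exact: right_wavelet_bounded hR.
have [B [gB gLB gRB]] : exists B : R,
  [/\ forall (b : bool) x, `|(if b then phi else psi0) x| <= B,
      forall (b : bool) n x, (n < N)%N ->
        `|(if b then phiL else psiL) n x| <= B &
      forall (b : bool) n x, (n < N)%N ->
        `|(if b then phiR else psiR) n x| <= B].
  have [B1 h1] := bphi; have [B2 h2] := daubechies_wavelet_bounded hd.
  have [B3 h3] := sup_bounded_family bphiL.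
  have [B4 h4] := sup_bounded_family bphiR.
  have [B5 h5] := sup_bounded_family bpsiL.
  have [B6 h6] := sup_bounded_family bpsiR.
  exists (Num.max B1 (Num.max B2 (Num.max B3 (Num.max B4 (Num.max B5 B6))))).
  by split=> -[] => [x|x|n x nN|n x nN|n x nN|n x nN];
    rewrite !le_max ?h1 ?h2 ?h3 ?h4 ?h5 ?h6 ?orbT.
have B0 : 0 <= B by apply: le_trans (gB true 0).
have g0 (b : bool) x : ~~ (0 <= x <= (2 * N).-1%:R) ->
    (if b then phi else psi0) x = 0.
  by case: b => xN; rewrite ?(daub_support hd)// (daubechies_wavelet_support hd).
pose dil (b : bool) := dilate N (if b then phi else psi0)
  (if b then phiL else psiL) (if b then phiR else psiR).
pose W : R := B * (N + (2 * N).-1.+1 + N)%:R.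
have W0 : 0 <= W by rewrite mulr_ge0.
have s1 : 1 <= Num.sqrt 2 :> R by rewrite -{1}(@sqrtr1 R); apply: ler_wsqrtr; lra.
exists (1 + (2 * (2 * c).+1)%:R * (Num.sqrt 2 ^+ c * W)).
  by rewrite ltr_pwDl// !mulr_ge0// exprn_ge0// sqrtr_ge0.
move=> l x x01.
have [q hq] : exists q : 'I_(2 ^ l) -> bool * nat * nat, forall k,
    [/\ ((q k).1.2 <= l + c)%N, (l <= (q k).1.2 + c)%N,
        ((q k).2 < 2 ^ (q k).1.2)%N & forall x, 0 <= x <= 1 ->
       psi (ix k) x = dil (q k).1.1 (q k).1.2 (q k).2 x].
  apply: (@fin_all_exists _ _ (fun (k : 'I_(2 ^ l)) (q : bool * nat * nat) =>
    [/\ (q.1.2 <= l + c)%N, (l <= q.1.2 + c)%N,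
        (q.2 < 2 ^ q.1.2)%N & forall x, 0 <= x <= 1 ->
       psi (ix k) x = dil q.1.1 q.1.2 q.2 x])) => k.
  have [j [m [h1 h2 h3 [[_ h4]|[_ h4]]]]] := hpsi l k.
    by exists (true, j, m).
  by exists (false, j, m).
have qinj : injective q.
  move=> k k' e; have : ix k = ix k'.
    apply: (onb_inj honb) => y y01.
    have [_ _ _ ->//] := hq k; have [_ _ _ ->//] := hq k'.
    by rewrite e.
  by move=> /eqP; rewrite /ix -tag_eqE /tag_eq/= eqxx/= tagged_asE => /eqP.
(* [inord] stores the shift j - l, which lies in [-c, c], as j + c - l. *)
pose t (k : 'I_(2 ^ l)) : bool * 'I_(2 * c).+1 :=
  ((q k).1.1, inord ((q k).1.2 + c - l)).
have tE k : nat_of_ord (t k).2 = ((q k).1.2 + c - l)%N.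
  rewrite /t/= inordK// ltnS; have [h1 _ _ _] := hq k.
  by rewrite leq_subLR mul2n -addnn addnA leq_add2r.
rewrite (partition_big t xpredT)//=.
apply: (@le_trans _ _
    (\sum_(p : bool * 'I_(2 * c).+1) Num.sqrt 2 ^+ (l + c) * W)).
  apply: ler_sum => p _.
  have jE k : t k == p -> (q k).1.2 = (p.2 + l - c)%N.
    move=> /eqP <-; rewrite tE; have [_ h2 _ _] := hq k.
    by rewrite subnK// addnK.
  rewrite (eq_bigr (fun k => `|dil p.1 (p.2 + l - c)%N (q k).2 x|)); last first.
    move=> k tk; rewrite -(jE _ tk) -(eqP tk) /=.
    by have [_ _ _ ->] := hq k.
  apply: (@le_trans _ _ (Num.sqrt 2 ^+ (p.2 + l - c) * W)).
    apply: dilate_sum_le => //.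
    - move=> k k'; rewrite !unfold_in => tk tk' e; apply: qinj.
      have e1 : (q k).1.1 = (q k').1.1 by move: tk tk' => /eqP<- /eqP[].
      have e2 : (q k).1.2 = (q k').1.2 by rewrite (jE _ tk) (jE _ tk').
      by move: e e1 e2; case: (q k) => -[? ?] ?; case: (q k') => -[? ?] ? /= -> -> ->.
    - by move=> k tk; rewrite -(jE _ tk); have [_ _ ->] := hq k.
    - exact: g0.
    - exact: gLB.
    - exact: gRB.
  rewrite ler_wpM2r// ler_weXn2l// leq_subLR addnCA addnn -mul2n addnC leq_add2l.
  by rewrite -ltnS.
rewrite sumr_const card_prod card_bool card_ord -[_ *+ _]mulr_natr exprD.
rewrite mulrDl mul1r -[leLHS]add0r lerD ?exprn_ge0 ?sqrtr_ge0//.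
by rewrite le_eqVlt; apply/orP; left; apply/eqP; ring.
Qed.

End Waves.
(** * Gaussian tails *)

Section Gauss.
Context {R : realType}.
Local Notation leb := (@lebesgue_measure R).

Lemma lebesgue_measure_shift (m : R) (A : set R) : measurable A ->
  pushforward leb ((fun x => m + x) : R -> measurableTypeR R) A = leb A.
Proof.
have mD : measurable_fun setT ((fun x => m + x) : R -> measurableTypeR R).
  exact: measurable_funD.
move=> mA; apply/esym/lebesgue_measure_unique => //= _ [[a b]] _ <-.
rewrite /pushforward.
rewrite (_ : _ @^-1` _ = [set` `]a - m, b - m]]); last first.
  by apply/seteqP; split=> x /=; rewrite !in_itv/= ltrBlDl lerBrDl.
rewrite !lebesgue_measure_itv/= !lte_fin ltrD2r.
by case: ifP => // _; rewrite -!EFinB; congr EFin; ring.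
Qed.

Lemma measurable_EFin_normal_pdf (m : R) (A : set R) :
  measurable_fun A (fun x : R => (normal_pdf m 1 x)%:E).
Proof.
apply: measurable_funTS; apply/measurable_EFinP; exact: measurable_normal_pdf.
Qed.

Lemma normal_prob_shift (m : R) (A : set R) : measurable A ->
  normal_prob m 1 A = normal_prob 0 1 [set x | A (m + x)].
Proof.
move=> mA; rewrite /normal_prob.
have mD : measurable_fun setT ((fun x => m + x) : R -> measurableTypeR R).
  exact: measurable_funD.
rewrite (eq_measure_integral
  (pushforward leb ((fun x => m + x) : R -> measurableTypeR R))); last first.
  by move=> B mB _; rewrite -[LHS](lebesgue_measure_shift m).
rewrite ge0_integral_pushforward//; last 2 first.
- exact: measurable_EFin_normal_pdf.
- by move=> x _; rewrite lee_fin normal_pdf_ge0.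
apply: eq_integral => x _ /=; congr EFin.
by rewrite !normal_pdfE ?oner_eq0// /normal_fun subr0 [m + x]addrC addrK.
Qed.

Lemma normal_prob_opp (A : set R) : measurable A ->
  normal_prob 0 1 A = normal_prob 0 1 [set x | A (- x)].
Proof.
move=> mA; rewrite /normal_prob.
have mD : measurable_fun setT (-%R : R -> measurableTypeR R).
  exact: oppr_measurable.
rewrite (eq_measure_integral
  (pushforward leb (-%R : R -> measurableTypeR R))); last first.
  by move=> B mB _; rewrite -[LHS]lebesgue_measureN.
rewrite ge0_integral_pushforward//; last 2 first.
- exact: measurable_EFin_normal_pdf.
- by move=> x _; rewrite lee_fin normal_pdf_ge0.
apply: eq_integral => x _ /=; congr EFin.
by rewrite !normal_pdfE ?oner_eq0// /normal_fun !subr0 sqrrN.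
Qed.

Definition gauss_tail (t : R) : R := fine (normal_prob 0 1 [set x : R | t < x]).

Lemma measurable_gt (t : R) : measurable [set x : R | t < x].
Proof.
rewrite (_ : [set _ | _] = [set` `]t, +oo[])//.
by apply/seteqP; split=> x /=; rewrite in_itv/= andbT.
Qed.

Lemma measurable_lt (t : R) : measurable [set x : R | x < t].
Proof.
by rewrite (_ : [set _ | _] = [set` `]-oo, t[]).
Qed.

Lemma normal_prob_fin (m : R) (A : set R) : measurable A ->
  (fine (normal_prob m 1 A))%:E = normal_prob m 1 A.
Proof. by move=> mA; rewrite fineK// (@fin_num_measure _ _ _ (normal_prob m 1)). Qed.

Lemma normal_upper_tail (m t : R) :
  normal_prob m 1 [set x | m + t < x] = (gauss_tail t)%:E.
Proof.
rewrite normal_prob_shift; last exact: measurable_gt.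
rewrite /gauss_tail normal_prob_fin; last exact: measurable_gt.
by congr normal_prob; apply/seteqP; split=> x /=; rewrite ltrD2l.
Qed.

Lemma normal_lower_tail (m t : R) :
  normal_prob m 1 [set x | x < m - t] = (gauss_tail t)%:E.
Proof.
rewrite normal_prob_shift; last exact: measurable_lt.
rewrite /gauss_tail normal_prob_fin; last exact: measurable_gt.
rewrite normal_prob_opp; last first.
  rewrite (_ : [set _ | _] = [set x : R | x < - t]); first exact: measurable_lt.
  by apply/seteqP; split=> x /=; rewrite ltrD2l.
by congr normal_prob; apply/seteqP; split=> x /=; rewrite ltrD2l ltrN2.
Qed.

(** The rays ]n, +oo[ decrease to the empty set. *)
Lemma gauss_tail_small (d : R) : 0 < d -> exists2 t : R, 0 < t & gauss_tail t <= d.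
Proof.
move=> d0.
pose F (n : nat) := [set x : R | n.+1%:R < x].
have := @nonincreasing_cvg_mu _ _ _ (normal_prob 0 1) F.
have -> : \bigcap_n F n = set0.
  apply/seteqP; split=> x //= xF; have := xF (Num.truncn x) I.
  by rewrite /F/= ltNge ltW// truncnS_gt// num_real.
rewrite measure0 => cF.
have {cF} /fine_cvg cF : (normal_prob 0 1 \o F) x @[x --> \oo] --> (0 : R)%:E.
  apply: cF => //.
  - by rewrite ltey_eq fin_num_measure//; exact: measurable_gt.
  - by move=> i; exact: measurable_gt.
  - move=> n m nm; apply/subsetPset => x /=; apply: le_lt_trans.
    by rewrite ler_nat.
have /cvgr_le/(_ d d0) cFd := cF.
near \oo => N; exists N.+1%:R => //.
by near: N; exact: cFd.
Unshelve. all: by end_near. Qed.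

(** By symmetry twice the tail is the mass outside [-t, t], and on this interval
    the density is at least its value at 1. *)
Lemma gauss_tail_le : exists2 c : R, 0 < c &
  forall t, 0 <= t <= 1 -> gauss_tail t <= 1 / 2 - c * t.
Proof.
exists (normal_pdf 0 1 1).
  by rewrite normal_pdfE ?oner_eq0// mulr_gt0 ?normal_peak_gt0 ?oner_eq0 ?expR_gt0.
move=> t /andP[t0 t1].
have mgt := measurable_gt t; have mlt := measurable_lt (- t).
have mid : ((2 * normal_pdf 0 1 1 * t)%:E <= normal_prob 0 1 [set` `[(- t), t]%R])%E.
  apply: (@le_trans _ _ (\int[leb]_(x in [set` `[(- t), t]%R]) (cst (normal_pdf 0 1 1)%:E x))%E).
    rewrite integral_cst//= lebesgue_measure_itv/= lte_fin.
    case: ltP => [_|tt]; last by rewrite mule0 lee_fin (_ : t = 0) ?mulr0//; lra.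
    by rewrite -EFinD -EFinM lee_fin le_eqVlt; apply/orP; left; apply/eqP; ring.
  apply: ge0_le_integral => //=.
  - by move=> x _; rewrite lee_fin normal_pdf_ge0.
  - exact: measurable_EFin_normal_pdf.
  - move=> x; rewrite in_itv/= => /andP[x1 x2].
    rewrite lee_fin !normal_pdfE ?oner_eq0// ler_wpM2l ?normal_peak_ge0//.
    rewrite /normal_fun ler_expR !subr0 !mulNr lerN2 ler_wpM2r//.
    by move: (x : R) x1 x2 => {}x x1 x2; nra.
have mlow : normal_prob 0 1 [set x | x < - t] = (gauss_tail t)%:E.
  by rewrite -(normal_lower_tail 0) sub0r.
have mup : normal_prob 0 1 [set x | t < x] = (gauss_tail t)%:E.
  by rewrite -(normal_upper_tail 0) add0r.
have mI : measurable [set` `[(- t), t]%R] by [].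
have : normal_prob 0 1
    ([set` `[(- t), t]%R] `|` ([set x | t < x] `|` [set x | x < - t])) = 1%E.
  rewrite (_ : _ `|` _ = [set: R]).
    exact: (@probability_setT _ _ _ (normal_prob 0 1)).
  apply/seteqP; split=> x //= _; rewrite in_itv/=.
  by case: (leP x t) => h1; case: (leP (-t) x) => h2; [left|right;right|right;left|right;left].
rewrite (@measureU _ _ _ (normal_prob 0 1))//; last 2 first.
- exact: measurableU.
- apply/seteqP; split=> x //= -[]; rewrite in_itv/= => /andP[h1 h2].
  by case; rewrite ltNge ?h1 ?h2.
rewrite (@measureU _ _ _ (normal_prob 0 1))//; last first.
  apply/seteqP; split=> x //= -[h1 h2]; lra.
move=> tot; have {tot} : (normal_prob 0 1 [set` `[(- t), t]%R] +
    (normal_prob 0 1 [set x | (t < x)%R] + normal_prob 0 1 [set x | (x < - t)%R]) = 1)%E.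
  exact: tot.
move: mid; rewrite -(normal_prob_fin 0 mI) mlow mup lee_fin -!EFinD => mid [].
lra.
Qed.

End Gauss.
(** * Majorities in an i.i.d. sample *)

Section Majority.
Context {R : realType}.

Lemma measure_bigsetU_le (d : measure_display) (T : measurableType d)
    (mu : {measure set T -> \bar R}) (I : Type) (r : seq I) (K : pred I)
    (F : I -> set T) : (forall i, measurable (F i)) ->
  (mu (\big[setU/set0]_(i <- r | K i) F i) <= \sum_(i <- r | K i) mu (F i))%E.
Proof.
move=> mF; elim: r => [|i r IH]; first by rewrite !big_nil measure0.
rewrite !big_cons; case: ifP => // _.
have mU : measurable (\big[setU/set0]_(j <- r | K j) F j).
  by apply: bigsetU_measurable => j _.
by rewrite (le_trans (measureU2 _ _ _))// leeD2l.
Qed.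

Section Pattern.
Context (d d' : measure_display) (T : measurableType d) (U : measurableType d')
  (n : nat) (Y : 'I_n -> T -> U) (A : set U).
Hypotheses (mY : forall i, measurable_fun setT (Y i)) (mA : measurable A).

Definition hits (w : T) : {set 'I_n} := [set i | `[< A (Y i w) >]]%SET.

(** The atoms of the algebra generated by the n events: every event on the set of
    hits is a finite union of them, and their probabilities are products. *)
Definition exact_hits (S : {set 'I_n}) : set T :=
  [set w | forall i, (if i \in S then A else ~` A) (Y i w)].

Lemma measurable_exact_hits S : measurable (exact_hits S).
Proof.
rewrite (_ : exact_hits S =
    \bigcap_(i in [set: 'I_n]) (Y i @^-1` (if i \in S then A else ~` A))).
  apply: fin_bigcap_measurable => // i _; rewrite -[X in measurable X]setTI.
  by apply: mY => //; case: ifP => // _; exact: measurableC.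
by apply/seteqP; split=> w /= h i => [_|]; apply: h.
Qed.

Lemma exact_hitsP S w : exact_hits S w <-> hits w = S.
Proof.
split=> [h|<- i]; last by rewrite inE; case: asboolP.
by apply/setP => i; rewrite inE; have := h i; case: ifP => _ => /asboolP//;
  move=> /asboolP h'; apply/asboolP.
Qed.

Lemma hits_predE (K : pred {set 'I_n}) :
  [set w | K (hits w)] = \big[setU/set0]_(S | K S) exact_hits S.
Proof.
apply/seteqP; split=> w /=; rewrite -bigcup_seq_cond.
  by move=> Kw; exists (hits w) => /=; [rewrite mem_index_enum|exact/exact_hitsP].
by move=> [S /= /andP[_ KS] /exact_hitsP ->].
Qed.

Lemma measurable_hits_pred (K : pred {set 'I_n}) :
  measurable [set w | K (hits w)].
Proof.
by rewrite hits_predE; apply: bigsetU_measurable => S _; exact: measurable_exact_hits.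
Qed.

End Pattern.

(** If at least half of the factors are the smaller number p, exchanging the
    surplus of p against q makes the numbers of p and q equal, whence the square
    is at most (p q) ^ n. *)
Lemma prod_pattern_le (n : nat) (S : {set 'I_n}) (p q : R) :
  0 <= p -> p <= q -> (n <= 2 * #|S|)%N ->
  \prod_(i < n) (if i \in S then p else q) <= Num.sqrt ((p * q) ^+ n).
Proof.
move=> p0 pq nS; have q0 : 0 <= q := le_trans p0 pq.
have -> : \prod_(i < n) (if i \in S then p else q) = p ^+ #|S| * q ^+ (n - #|S|).
  rewrite (bigID (mem S))/= (eq_bigr (fun=> p)); last by move=> i ->.
  rewrite prodr_const; congr (_ * _).
  rewrite (eq_bigr (fun=> q)); last by move=> i /negbTE ->.
  rewrite (eq_bigl (mem (~: S)%SET)); last by move=> i; rewrite !inE.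
  by rewrite prodr_const cardsCs finset.setCK card_ord.
have Sn : (#|S| <= n)%N by rewrite -[leqRHS]card_ord max_card.
rewrite -[leLHS]ger0_norm ?mulr_ge0 ?exprn_ge0// -sqrtr_sqr ler_wsqrtr//.
rewrite exprMn -!exprM mulnC [((n - _) * 2)%N]mulnC.
rewrite -{1}(subnKC nS) exprD exprMn -mulrA ler_wpM2l ?exprn_ge0//.
rewrite [leRHS](_ : _ = q ^+ (2 * #|S| - n) * q ^+ (2 * (n - #|S|))).
  by rewrite ler_wpM2r ?exprn_ge0// lerXn2r.
by rewrite -exprD; congr (_ ^+ _); lia.
Qed.

(** There are at most 2 ^ n patterns with at least n/2 hits, each of probability
    at most (p (1 - p)) ^ (n/2), and
    4 p (1 - p) = 1 - (1 - 2 p) ^ 2 <= 1 - 4 del ^ 2 <= exp (- 4 del ^ 2).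
    This crude count already gives the exponent of Hoeffding's inequality. *)
Lemma majority_tail (d : measure_display) (T : measurableType d)
    (P : probability T R) (n : nat) (law : set (wseq R) -> \bar R)
    (Y : 'I_n -> T -> wseq R) (A : set (wseq R)) (p del : R) :
  iid_sample P law Y -> measurable A ->
  law A = p%:E -> law (~` A) = (1 - p)%:E -> 0 <= p -> p <= 1 / 2 - del ->
  0 <= del ->
  (P [set w | (n <= 2 * #|hits Y A w|)%N] <= (expR (- (2 * n%:R * del ^+ 2)))%:E)%E.
Proof.
move=> [mY iid] mA lA lAc p0 pd del0.
rewrite (hits_predE Y A (fun S => (n <= 2 * #|S|)%N)).
apply: le_trans.
  by apply: measure_bigsetU_le => S; exact: measurable_exact_hits.
have PE (S : {set 'I_n}) : (n <= 2 * #|S|)%N ->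
    (P (exact_hits Y A S) <= (Num.sqrt ((p * (1 - p)) ^+ n))%:E)%E.
  move=> nS; rewrite (iid (fun i => if i \in S then A else ~` A)); last first.
    by move=> i; case: ifP => // _; exact: measurableC.
  rewrite (eq_bigr (fun i => (if i \in S then p else 1 - p)%:E)); last first.
    by move=> i _; case: ifP.
  rewrite prodEFin lee_fin; apply: prod_pattern_le => //; lra.
apply: (@le_trans _ _ (\sum_(S : {set 'I_n}) (Num.sqrt ((p * (1 - p)) ^+ n))%:E)%E).
  rewrite big_mkcond; apply: lee_sum => S _; case: ifP => [/PE//|_].
  by rewrite lee_fin sqrtr_ge0.
rewrite sumEFin lee_fin sumr_const -cardsT -powersetT card_powerset cardsT.
rewrite card_ord -[_ *+ _]mulr_natl.
have -> : (2 ^ n)%:R = Num.sqrt (4 ^+ n) :> R.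
  rewrite natrX (_ : 4 = 2 ^+ 2); last by ring.
  by rewrite -exprM mulnC exprM sqrtr_sqr ger0_norm// exprn_ge0.
rewrite -sqrtrM ?exprn_ge0// -exprMn.
have -> : expR (- (2 * n%:R * del ^+ 2)) = Num.sqrt (expR (- (4 * del ^+ 2)) ^+ n).
  rewrite -expRM_natl (_ : n%:R * _ = 2 * - (2 * n%:R * del ^+ 2)); last by ring.
  by rewrite expRM_natl sqrtr_sqr ger0_norm// expR_ge0.
apply/ler_wsqrtr/lerXn2r; rewrite ?nnegrE ?expR_ge0 ?mulr_ge0//; first by lra.
apply: le_trans (expR_ge1Dx _); nra.
Qed.

End Majority.

(** * Medians *)

Section Median.
Context {R : realType}.

(** Order statistics are compared with a threshold by counting; this is the only
    property of sorting that the median needs. *)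
Lemma count_sorted (p : pred R) (t : seq R) k :
  (forall x y, x <= y -> p y -> p x) -> sorted <=%R t -> (k < size t)%N ->
  p (nth 0 t k) = (k < count p t)%N.
Proof.
move=> pdown st kt; rewrite -[in RHS](cat_take_drop k t) count_cat.
have nthle i j : (i <= j < size t)%N -> nth 0 t i <= nth 0 t j.
  move=> /andP[ij jt]; apply: le_sorted_leq_nth => //.
  by rewrite inE (leq_ltn_trans ij).
have [pk|pk] := boolP (p (nth 0 t k)).
  have /eqP -> : count p (take k t) == size (take k t).
    rewrite -all_count.
    apply/(all_nthP 0) => i; rewrite size_takel ?(ltnW kt)// => ik.
    rewrite nth_take//; apply: pdown pk; apply: nthle.
    by rewrite (ltnW ik) kt.
  by rewrite size_takel ?(ltnW kt)// (drop_nth 0)//= pk -[X in (X < _)%N]addn0 ltn_add2l.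
have -> : count p (drop k t) = 0%N.
  apply/eqP; rewrite -leqn0 leqNgt -has_count; apply/hasPn => x /(nthP 0)[i].
  rewrite size_drop => ik <-; rewrite nth_drop; apply: contra pk; apply: pdown.
  by apply: nthle; rewrite leq_addr/= -ltn_subRL.
by apply/esym/negbTE; rewrite addn0 -leqNgt (leq_trans (count_size _ _))// size_take kt.
Qed.

Lemma median_gt (s : seq R) (v : R) :
  (0 < size s)%N -> v < median s -> (size s <= 2 * count (fun x => v < x)%R s)%N.
Proof.
move=> s0; rewrite /median; set t := sort _ s => vm.
have st : sorted <=%R t by exact: sort_le_sorted.
have szt : size t = size s by rewrite size_sort.
have bt : ((size s)./2 < size t)%N by rewrite szt; lia.
have ab : nth 0 t (size s).-1./2 <= nth 0 t (size s)./2.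
  apply: le_sorted_leq_nth => //; rewrite ?inE ?szt; lia.
(* the larger of the two middle values dominates their mean *)
have vb : v < nth 0 t (size s)./2 by lra.
have := @count_sorted (fun x => x <= v) t (size s)./2.
rewrite leNgt vb/= => /(_ _ st bt) h.
have {h} : (count (fun x => (x <= v)%R) t <= (size s)./2)%N.
  by rewrite leqNgt -h// => x y; exact: le_trans.
have := count_predC (fun x => x <= v) t; rewrite szt.
rewrite (eq_count (a1 := predC _) (a2 := fun x => v < x)); last first.
  by move=> x /=; rewrite ltNge.
rewrite /t !count_sort.
by move: (count _ s) (count _ s) => a b; lia.
Qed.

Lemma median_lt (s : seq R) (v : R) :
  (0 < size s)%N -> median s < v -> (size s <= 2 * count (fun x => x < v)%R s)%N.
Proof.
move=> s0; rewrite /median; set t := sort _ s => vm.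
have st : sorted <=%R t by exact: sort_le_sorted.
have szt : size t = size s by rewrite size_sort.
have bt : ((size s)./2 < size t)%N by rewrite szt; lia.
have at' : ((size s).-1./2 < size t)%N by rewrite szt; lia.
have ab : nth 0 t (size s).-1./2 <= nth 0 t (size s)./2.
  apply: le_sorted_leq_nth => //; rewrite ?inE ?szt; lia.
have vb : nth 0 t (size s).-1./2 < v by lra.
have := @count_sorted (fun x => x < v) t (size s).-1./2.
rewrite vb => /(_ _ st at'); rewrite count_sort => h.
have {h} : ((size s).-1./2 < count (fun x => (x < v)%R) s)%N.
  by rewrite -h// => x y; exact: le_lt_trans.
by lia.
Qed.

Lemma count_hits (d d' : measure_display) (T : measurableType d)
    (U : measurableType d') (n : nat) (Y : 'I_n -> T -> U) (g : U -> R)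
    (p : pred R) (w : T) :
  count p [seq g (Y i w) | i <- enum 'I_n] = #|hits Y [set y | p (g y)] w|.
Proof.
rewrite count_map cardE -size_filter enumT; congr size; apply: eq_filter => i.
by rewrite /= inE; apply/idP/asboolP.
Qed.

Lemma measurable_median (d : measure_display) (T : measurableType d) (n : nat)
    (X : 'I_n -> T -> R) : (forall i, measurable_fun setT (X i)) ->
  measurable_fun setT (fun w => median [seq X i w | i <- enum 'I_n]).
Proof.
move=> mX.
have mnth k : measurable_fun setT
    (fun w => nth 0 (sort <=%R [seq X i w | i <- enum 'I_n]) k).
  have [nk|kn] := leqP n k.
    rewrite (_ : (fun _ => _) = cst 0)//; apply/funext => w.
    by rewrite nth_default// size_sort size_map size_enum_ord.
  apply: (measurability _ (RGenInftyO.measurableE R)).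
  move=> _ [_ [c ->] <-]; rewrite setTI.
  rewrite (_ : _ @^-1` _ =
      [set w | (k < #|hits X [set x | (x < c)%R] w|)%N]).
    exact: (measurable_hits_pred mX (measurable_lt c)
      (fun S : {set 'I_n} => (k < #|S|)%N)).
  have E w : (nth 0 (sort <=%R [seq X i w | i <- enum 'I_n]) k < c)%R =
      (k < #|hits X [set x | (x < c)%R] w|)%N.
    have -> : #|hits X [set x | (x < c)%R] w| =
        count (fun x => x < c)%R (sort <=%R [seq X i w | i <- enum 'I_n]).
      by rewrite count_sort (count_hits X id).
    apply: (@count_sorted (fun x => x < c)).
    - by move=> x y; exact: le_lt_trans.
    - exact: sort_le_sorted.
    - by rewrite size_sort size_map size_enum_ord.
  by apply/seteqP; split=> w /=; rewrite in_itv/= E.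
have -> : (fun w => median [seq X i w | i <- enum 'I_n]) =
   (fun w => (nth 0 (sort <=%R [seq X i w | i <- enum 'I_n]) n.-1./2 +
     nth 0 (sort <=%R [seq X i w | i <- enum 'I_n]) n./2) / 2).
  by apply/funext => w; rewrite /median size_map size_enum_ord.
apply: measurable_funM => //; exact: measurable_funD.
Qed.

End Median.
(** * Measurability of the error event *)

Section EventMeasurable.
Context {R : realType}.

(** The complement is the preimage, under finitely many random variables, of a
    union of open sets, hence of countably many boxes with rational corners:
    this removes the uncountable quantifier over [v] without any regularity of
    [g] and [h]. *)
Lemma measurable_forall_affine (d : measure_display) (T : measurableType d)
    (I : finType) (V : Type) (D : set V) (X : I -> T -> R)
    (g : V -> I -> R) (h : V -> R) (r : R) :
  (forall i, measurable_fun setT (X i)) ->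
  measurable [set w | forall v, D v -> `|\sum_i X i w * g v i - h v| <= r].
Proof.
move=> mX.
pose box (q : {ffun I -> rat * rat}) : set (I -> R) :=
  [set z | forall i, ratr (q i).1 < z i < ratr (q i).2].
pose bad : set (I -> R) :=
  [set z | exists2 v, D v & r < `|\sum_i z i * g v i - h v|].
have mbox q : measurable [set w | box q (X^~ w)].
  rewrite (_ : [set _ | _] = \bigcap_(i in [set: I])
      ([set w | X i w > ratr (q i).1] `&` [set w | X i w < ratr (q i).2])).
    apply: fin_bigcap_measurable => // i _; apply: measurableI.
      rewrite -[X in measurable X]setTI.
      by apply: (mX i measurableT _ (measurable_gt (ratr (q i).1))).
    rewrite -[X in measurable X]setTI.
    by apply: (mX i measurableT _ (measurable_lt (ratr (q i).2))).
  apply/seteqP; split=> w /= qw i => [_|]; first by have /andP := qw i.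
  by have [-> ->] := qw i Logic.I.
rewrite -[X in measurable X]setCK; apply: measurableC.
rewrite (_ : ~` _ = \bigcup_q
    (if `[< box q `<=` bad >] then [set w | box q (X^~ w)] else set0)); last first.
  apply/seteqP; split=> w /=; last first.
    move=> [q _]; case: ifP => // /asboolP qbad /qbad[v Dv vr] /(_ v Dv).
    by rewrite leNgt vr.
  move=> /existsNP[v /not_implyP[Dv /negP]]; rewrite -ltNge => vr.
  (* moving every variable by at most e moves the affine form by at most e s,
     which is less than the margin above r *)
  pose s := \sum_i `|g v i|.
  pose e := (`|\sum_i X i w * g v i - h v| - r) / (1 + s).
  have s0 : 0 <= s by apply: sumr_ge0.
  have e0 : 0 < e by rewrite divr_gt0// ?subr_gt0// ltr_pwDl.
  have [q hq] : exists q : I -> rat * rat, forall i,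
      X i w - e < ratr (q i).1 < X i w /\ X i w < ratr (q i).2 < X i w + e.
    apply: (@fin_all_exists _ _ (fun i (q : rat * rat) =>
      X i w - e < ratr q.1 < X i w /\ X i w < ratr q.2 < X i w + e)) => i.
    have [q1 h1] : exists q : rat, ratr q \in `](X i w - e), (X i w)[%R.
      by apply: rat_in_itvoo; rewrite ltrBlDr ltrDl.
    have [q2 h2] : exists q : rat, ratr q \in `](X i w), (X i w + e)[%R.
      by apply: rat_in_itvoo; rewrite ltrDl.
    by exists (q1, q2); move: h1 h2; rewrite !in_itv.
  exists [ffun i => q i] => //; case: ifP => [_|/asboolP[]] /=.
    by move=> i; rewrite ffunE; have [/andP[_ ->] /andP[->]] := hq i.
  move=> z zq; exists v => //.
  have zX i : `|X i w - z i| <= e.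
    have := zq i; rewrite ffunE => /andP[h1 h2].
    have [/andP[h3 h4] /andP[h5 h6]] := hq i; rewrite ler_norml; lra.
  have : `|\sum_i X i w * g v i - \sum_i z i * g v i| <= e * s.
    rewrite -sumrB (le_trans (ler_norm_sum _ _ _))// /s mulr_sumr.
    by apply: ler_sum => i _; rewrite -mulrBl normrM ler_wpM2r.
  have es : e * s < `|\sum_i X i w * g v i - h v| - r.
    rewrite /e mulrAC ltr_pdivrMr ?ltr_pwDl// ltr_pM2l ?subr_gt0//.
    by rewrite ltrDr.
  set a := \sum_i X i w * g v i in es *; set b := \sum_i z i * g v i => ab.
  have : `|a - h v| <= `|a - b| + `|b - h v|.
    by rewrite (le_trans _ (ler_normD _ _))// addrA subrK.
  lra.
apply: countable_bigcupT_measurable; first exact: countableP.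
by move=> q; case: ifP.
Qed.

Lemma sup01_sqr_le (g : R -> R) (c : R) : 0 <= c ->
  (sup01 g ^+ 2 <= c%:E)%E <-> (forall x, 0 <= x <= 1 -> `|g x| <= Num.sqrt c).
Proof.
move=> c0.
have ub x : 0 <= x <= 1 -> (`|g x|%:E <= sup01 g)%E.
  by move=> x01; apply: ereal_sup_ubound; exists x => //; rewrite /I01/= in_itv.
have sup0 : (0 <= sup01 g)%E.
  by apply: le_trans (ub 0 _); rewrite ?lee_fin// lexx ler01.
split=> [h x x01|h].
  rewrite -[leLHS]ger0_norm// -sqrtr_sqr ler_wsqrtr// -lee_fin.
  apply: le_trans h; rewrite expe2 expr2 EFinM.
  by apply: lee_pmul; rewrite ?lee_fin//; exact: ub.
have hs : (sup01 g <= (Num.sqrt c)%:E)%E.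
  apply: ge_ereal_sup => _ [x + <-]; rewrite /I01/= in_itv/= lee_fin => x01.
  exact: h.
apply: (@le_trans _ _ ((Num.sqrt c)%:E * (Num.sqrt c)%:E)%E).
  by rewrite expe2; apply: lee_pmul.
by rewrite -EFinM -expr2 sqr_sqrtr.
Qed.

End EventMeasurable.
(** * Deviation of the coordinatewise medians *)

Section Deviation.
Context {R : realType}.
Implicit Types (Pf Q : probability (wseq R) R).

Lemma measurable_coord (a : widx) :
  measurable_fun setT (fun y : wseq R => (y : widx -> R) a).
Proof.
move=> _ B mB; rewrite setTI; apply: sub_sigma_algebra.
by exists a, B.
Qed.

Definition above (a : widx) (x : R) : set (wseq R) := [set y | x < (y : widx -> R) a].
Definition below (a : widx) (x : R) : set (wseq R) := [set y | (y : widx -> R) a < x].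

Lemma measurable_above a x : measurable (above a x).
Proof.
rewrite -[X in measurable X]setTI.
exact: (measurable_coord a measurableT (measurable_gt x)).
Qed.

Lemma measurable_below a x : measurable (below a x).
Proof.
rewrite -[X in measurable X]setTI.
exact: (measurable_coord a measurableT (measurable_lt x)).
Qed.

Lemma contaminate_fin eps Pf Q (A : set (wseq R)) :
  measurable A -> contaminate eps Pf Q A =
  ((1 - eps) * fine (Pf A) + eps * fine (Q A))%:E.
Proof.
by move=> mA; rewrite /contaminate [RHS]EFinD !EFinM !fineK// fin_num_measure.
Qed.

(** Under contamination an event has still a probability p and its complement
    1 - p; the contaminating law enters only through Q A <= 1. *)
Lemma contaminate_tail eps Pf Q (A : set (wseq R)) (g : R) :
  0 <= eps <= 1 -> measurable A -> (Pf A <= g%:E)%E ->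
  exists p : R, [/\ contaminate eps Pf Q A = p%:E,
    contaminate eps Pf Q (~` A) = (1 - p)%:E, 0 <= p & p <= (1 - eps) * g + eps].
Proof.
move=> /andP[e0 e1] mA Ag; rewrite !contaminate_fin//; last exact: measurableC.
have fPA : Pf A \is a fin_num by rewrite fin_num_measure.
have fQA : Q A \is a fin_num by rewrite fin_num_measure.
rewrite !probability_setC// -(fineK fPA) -(fineK fQA) /=.
have Pf0 : 0 <= fine (Pf A) by rewrite fine_ge0.
have Q0 : 0 <= fine (Q A) by rewrite fine_ge0.
have Q1 : fine (Q A) <= 1 by rewrite -lee_fin fineK// probability_le1.
have Pg : fine (Pf A) <= g by rewrite -lee_fin fineK.
eexists; split; first reflexivity.
- by congr EFin; ring.
- by rewrite addr_ge0// mulr_ge0//; lra.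
- by nra.
Qed.

Lemma signal_marginal psi f Pf a (B : set R) :
  signal_law psi f Pf -> measurable B ->
  Pf [set y | B ((y : widx -> R) a)] = normal_prob (inner01 f (psi a)) 1 B.
Proof.
move=> hs mB; have := hs [:: a] (fun=> B) isT (fun=> mB).
rewrite big_seq1 => <-; congr (Pf _); apply/seteqP; split=> y /=.
  by move=> Ba b; rewrite inE => /eqP ->.
by apply; rewrite inE.
Qed.

Lemma signal_above psi f Pf a t : signal_law psi f Pf ->
  Pf (above a (inner01 f (psi a) + t)) = (gauss_tail t)%:E.
Proof.
move=> hs; rewrite -(normal_upper_tail (inner01 f (psi a))).
exact: (signal_marginal a hs (measurable_gt _)).
Qed.

Lemma signal_below psi f Pf a t : signal_law psi f Pf ->
  Pf (below a (inner01 f (psi a) - t)) = (gauss_tail t)%:E.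
Proof.
move=> hs; rewrite -(normal_lower_tail (inner01 f (psi a))).
exact: (signal_marginal a hs (measurable_lt _)).
Qed.

Section Sample.
Context (psi : widx -> R -> R) (f : R -> R) (eps : R) (Pf Q : probability (wseq R) R)
  (d : measure_display) (T : measurableType d) (P : probability T R) (n : nat)
  (Y : 'I_n -> T -> wseq R).
Hypotheses (eps0 : 0 <= eps) (eps1 : eps < 1 / 4) (n0 : (0 < n)%N)
  (hs : signal_law psi f Pf) (hY : iid_sample P (contaminate eps Pf Q) Y).

Definition med (a : widx) (w : T) : R :=
  median [seq (Y i w : widx -> R) a | i <- enum 'I_n].

Lemma measurable_med a : measurable_fun setT (med a).
Proof.
apply: measurable_median => i.
exact: (measurableT_comp (measurable_coord a) (hY.1 i)).
Qed.

Definition far (a : widx) (t : R) : set T :=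
  [set w | t < `|med a w - inner01 f (psi a)|].

Lemma measurable_far a t : measurable (far a t).
Proof.
have mf : measurable_fun setT (fun w => `|med a w - inner01 f (psi a)|).
  apply: measurableT_comp => //; apply: measurable_funB => //; exact: measurable_med.
by rewrite -[X in measurable X]setTI; apply: (mf measurableT _ (measurable_gt t)).
Qed.

Lemma far_majority a t w : far a t w ->
  (n <= 2 * #|hits Y (above a (inner01 f (psi a) + t)%R) w|)%N \/
  (n <= 2 * #|hits Y (below a (inner01 f (psi a) - t)%R) w|)%N.
Proof.
rewrite /far/= /med; set m := inner01 f (psi a).
set s := [seq (Y i w : widx -> R) a | i <- enum 'I_n].
have sz : size s = n by rewrite size_map size_enum_ord.
rewrite ltr_normr => /orP[h|h]; [left|right].
- rewrite -(count_hits Y (fun y : wseq R => (y : widx -> R) a) (fun x => (m + t < x)%R)).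
  by rewrite -[leqLHS]sz; apply: median_gt; rewrite ?sz//; move: h; lra.
- rewrite -(count_hits Y (fun y : wseq R => (y : widx -> R) a) (fun x => (x < m - t)%R)).
  by rewrite -[leqLHS]sz; apply: median_lt; rewrite ?sz//; move: h; lra.
Qed.

Lemma med_tail a (t del : R) : 0 <= del ->
  (1 - eps) * gauss_tail t + eps <= 1 / 2 - del ->
  (P (far a t) <= (2 * expR (- (2 * n%:R * del ^+ 2)))%:E)%E.
Proof.
move=> del0 hdel; set m := inner01 f (psi a).
have mHi := measurable_above a (m + t); have mLo := measurable_below a (m - t).
have e01 : 0 <= eps <= 1 by rewrite eps0/=; move: eps1; lra.
have maj A : measurable A -> (Pf A <= (gauss_tail t)%:E)%E ->
    (P [set w | (n <= 2 * #|hits Y A w|)%N] <= (expR (- (2 * n%:R * del ^+ 2)))%:E)%E.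
  move=> mA hA; have [p [lA lAc p0 pg]] := contaminate_tail Q e01 mA hA.
  by apply: (majority_tail hY mA lA lAc) => //; exact: le_trans hdel.
have PHi : (Pf (above a (m + t)) <= (gauss_tail t)%:E)%E.
  by rewrite (signal_above _ _ hs).
have PLo : (Pf (below a (m - t)) <= (gauss_tail t)%:E)%E.
  by rewrite (signal_below _ _ hs).
have mhits A : measurable A -> measurable [set w | (n <= 2 * #|hits Y A w|)%N].
  move=> mA; exact: (measurable_hits_pred hY.1 mA
    (fun S : {set 'I_n} => (n <= 2 * #|S|)%N)).
rewrite mulr_natl mulr2n EFinD.
apply: le_trans (leeD (maj _ mHi PHi) (maj _ mLo PLo)).
apply: le_trans (measureU2 _ (mhits _ mHi) (mhits _ mLo)).
apply: le_measure; rewrite ?inE//.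
- exact: measurable_far.
- by apply: measurableU; exact: mhits.
by move=> w /far_majority.
Qed.

Context (J : finType) (a : J -> widx).

Definition some_far (t : R) : set T := [set w | exists j, far (a j) t w].

Lemma some_farE t : some_far t = \big[setU/set0]_j far (a j) t.
Proof.
apply/seteqP; split=> w /=; rewrite -bigcup_seq.
  by move=> [j jw]; exists j => //=; rewrite mem_index_enum.
by move=> [j _ jw]; exists j.
Qed.

Lemma measurable_some_far t : measurable (some_far t).
Proof. by rewrite some_farE; apply: bigsetU_measurable => j _; exact: measurable_far. Qed.

(** The tail is evaluated at [t] because [gauss_tail_le] is limited to small
    thresholds, while [t'] can be any larger multiple of the rate. *)
Lemma some_far_tail (t t' del : R) : t <= t' -> 0 <= del ->
  (1 - eps) * gauss_tail t + eps <= 1 / 2 - del ->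
  (P (some_far t') <= (#|J|%:R * (2 * expR (- (2 * n%:R * del ^+ 2))))%:E)%E.
Proof.
move=> tt' del0 hdel; apply: (@le_trans _ _ (P (some_far t))).
  apply: le_measure; rewrite ?inE; try exact: measurable_some_far.
  by move=> w [j jw]; exists j; exact: le_lt_trans jw.
rewrite some_farE; apply: le_trans.
  by apply: measure_bigsetU_le => j; exact: measurable_far.
apply: (@le_trans _ _ (\sum_(j : J) (2 * expR (- (2 * n%:R * del ^+ 2)))%:E)%E).
  by apply: lee_sum => j _; exact: med_tail.
by rewrite sumEFin lee_fin sumr_const -[leLHS]mulr_natl.
Qed.

(** All the observations avoid the tails of all the coordinates with probability
    at least (3/4 * 1/2) ^ n, and then so do the medians.  Contrary to
    [some_far_tail], the coordinates are handled jointly in each observation,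
    so that the bound stays below 1 for every n. *)
Lemma some_far_clean (t t' : R) : t <= t' ->
  #|J|%:R * (2 * gauss_tail t) <= 1 / 2 ->
  (P (some_far t') <= (1 - (3 / 8) ^+ n)%:E)%E.
Proof.
move=> tt' hJ.
pose m j := inner01 f (psi (a j)).
pose W j := above (a j) (m j + t) `|` below (a j) (m j - t).
have mHi j : measurable (above (a j) (m j + t)) by exact: measurable_above.
have mLo j : measurable (below (a j) (m j - t)) by exact: measurable_below.
have mW j : measurable (W j) by exact: measurableU.
pose G := ~` (\big[setU/set0]_j W j).
have mU : measurable (\big[setU/set0]_j W j) by exact: bigsetU_measurable.
have mG : measurable G by exact: measurableC.
have PU : (Pf (\big[setU/set0]_j W j) <= (1 / 2)%:E)%E.
  apply: (le_trans (measure_bigsetU_le _ _ _ mW)).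
  apply: (@le_trans _ _ (\sum_(j : J) (2 * gauss_tail t)%:E)%E).
    apply: lee_sum => j _; apply: (le_trans (measureU2 _ (mHi j) (mLo j))).
    rewrite mulr_natl mulr2n EFinD.
    have hi : (Pf (above (a j) (m j + t)) <= (gauss_tail t)%:E)%E.
      by rewrite (signal_above _ _ hs).
    have lo : (Pf (below (a j) (m j - t)) <= (gauss_tail t)%:E)%E.
      by rewrite (signal_below _ _ hs).
    exact: leeD hi lo.
  by rewrite sumEFin lee_fin sumr_const -[leLHS]mulr_natl.
have PG : ((1 / 2)%:E <= Pf G)%E.
  rewrite probability_setC// (_ : (1 / 2)%:E = (1 - (1 / 2)%:E)%E).
    exact: leeB.
  by rewrite -EFinB; congr EFin; lra.
have allG : measurable [set w | forall i, G (Y i w)].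
  rewrite (_ : [set _ | _] = exact_hits Y G [set: 'I_n]%SET).
    by apply: measurable_exact_hits => //; exact: hY.1.
  by apply/seteqP; split=> w /= h i; have := h i; rewrite finset.in_setT.
have PallG : (((3 / 8) ^+ n)%:E <= P [set w | forall i, G (Y i w)])%E.
  rewrite (hY.2 (fun=> G))// contaminate_fin// prodEFin lee_fin prodr_const card_ord.
  have PGr : 1 / 2 <= fine (Pf G) by rewrite -lee_fin fineK// fin_num_measure.
  have QGr : 0 <= fine (Q G) by rewrite fine_ge0.
  by apply: lerXn2r; rewrite ?nnegrE; move: eps0 eps1; nra.
rewrite EFinB; apply: (@le_trans _ _ (P (~` [set w | forall i, G (Y i w)]))).
  apply: le_measure; rewrite ?inE; [exact: measurable_some_far|exact: measurableC|].
  move=> w [j jw] /= hG.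
  have noW (A : set (wseq R)) : A `<=` W j -> hits Y A w = finset.set0.
    move=> AW; apply/setP => i; rewrite !inE; apply/negbTE/asboolP => Ai.
    by apply: (hG i); rewrite -bigcup_seq; exists j; [rewrite /= mem_index_enum|exact: AW].
  have : far (a j) t w by exact: le_lt_trans jw.
  have AW : above (a j) (m j + t) `<=` W j by move=> y; left.
  have BW : below (a j) (m j - t) `<=` W j by move=> y; right.
  by move=> /far_majority; rewrite (noW _ AW) (noW _ BW) cards0 muln0 leqNgt n0; case.
by rewrite probability_setC// leeB.
Qed.

End Sample.
End Deviation.
(** * Simultaneous concentration of the medians *)

Section Concentration.
Context {R : realType}.

Lemma expR_dominates_linear : exists2 n0 : nat, (0 < n0)%N &
  forall n, (n0 <= n)%N -> 8 * n%:R <= expR (n%:R / 64) :> R.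
Proof.
pose K : R := 64 * 1024; exists (Num.truncn K).+1 => // n n0n.
have nK : 1024 <= n%:R / 64 :> R.
  rewrite ler_pdivlMr// mulrC; apply: ltW; apply: lt_le_trans (truncnS_gt K) _.
  by rewrite ler_nat.
have x0 : 0 <= n%:R / 64 :> R by lra.
apply: le_trans (expR_ge1Dxn 1 x0).
have nE : n%:R = 64 * (n%:R / 64) :> R by field.
rewrite [in leLHS]nE; move: (n%:R / 64) nK => x nK.
by rewrite (_ : (2`!)%:R = 2 :> R)//; nra.
Qed.

Lemma ln_nat_bounds (n : nat) : (2 <= n)%N ->
  [/\ 0 < n%:R :> R, 0 < ln (n%:R : R) & ln (n%:R : R) <= n%:R].
Proof.
move=> n2; have n1 : 1 < n%:R :> R by rewrite ltr1n.
have n0 : 0 < n%:R :> R by apply: lt_trans n1.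
split=> //; first by rewrite ln_gt0.
by rewrite -ler_expR lnK// (le_trans _ (expR_ge1Dx _))//; lra.
Qed.

(** [4 * n] is what the cutoff guarantees.  Below, [t0] is the fixed threshold of
    the regime where r is bounded below, and [T0] the threshold that makes the
    union bound over the at most 4 n0 coordinates at most 1/2 when n < n0. *)
Lemma medians_concentrate : exists C1 C' : R, [/\ 0 < C1, 0 < C' &
  forall (psi : widx -> R -> R) (f : R -> R) (eps : R) (n : nat)
    (Pf Q : probability (wseq R) R) (d : measure_display) (T : measurableType d)
    (P : probability T R) (Y : 'I_n -> T -> wseq R),
  0 <= eps -> eps < 1 / 4 -> (2 <= n)%N ->
  signal_law psi f Pf -> iid_sample P (contaminate eps Pf Q) Y ->
  forall (J : finType) (a : J -> widx), (#|J| <= 4 * n)%N ->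
  (P (some_far psi f Y a (C1 * (eps + Num.sqrt (ln n%:R / n%:R)))) <=
   (expR (- (C' * (ln n%:R + n%:R * eps ^+ 2))))%:E)%E].
Proof.
have [c c0 hc] := @gauss_tail_le R.
have [t0 t00 ht0] := @gauss_tail_small R (1 / 8) ltac:(lra).
have [n0 n00 hn0] := expR_dominates_linear.
have n0R : 0 < n0%:R :> R by rewrite ltr0n.
have [T0 T00 hT0] := @gauss_tail_small R (1 / (16 * n0%:R)) ltac:(by rewrite divr_gt0// mulr_gt0).
(* (3/4) c C0 = 5/2: the shift eps / 2 <= r / 2 leaves the margin 2 r. *)
pose C0 : R := 10 / 3 / c.
have C00 : 0 < C0 by rewrite divr_gt0//; lra.
have ln2 : 0 < ln (2 : R) by rewrite ln_gt0// ltr1n.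
pose r0 : R := Num.sqrt (ln 2 / n0%:R).
have r00 : 0 < r0 by rewrite sqrtr_gt0 divr_gt0.
have u0 := mulr_gt0 t00 C00; have v0 := divr_gt0 T00 r00.
pose C1 := C0 + t0 * C0 + T0 / r0.
have [C1C0 C1u C1v] : [/\ C0 <= C1, t0 * C0 <= C1 & T0 / r0 <= C1].
  by rewrite /C1; move: (t0 * C0) (T0 / r0) u0 v0 => u v; split; lra.
pose C' : R := Num.min (1 / 128) ((3 / 8) ^+ n0 / (2 * n0%:R)).
have C'0 : 0 < C'.
  by rewrite lt_min; apply/andP; split; [lra|rewrite divr_gt0 ?exprn_gt0 ?mulr_gt0//; lra].
have C'1 : C' <= 1 / 128 by rewrite ge_min lexx.
have C'2 : C' * (2 * n0%:R) <= (3 / 8) ^+ n0.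
  by rewrite -ler_pdivlMr ?mulr_gt0// ge_min lexx orbT.
exists C1, C'; split=> //.
  exact: lt_le_trans C1C0.
move=> psi f eps n Pf Q d T P Y e0 e1 n2 hs hY J a hJ.
have [nR lnn0 lnn] := ln_nat_bounds n2.
have n1 : (0 < n)%N by exact: ltn_trans n2.
have [q qE] : exists q : R, q = Num.sqrt (ln n%:R / n%:R) by eexists.
have [r rE] : exists r : R, r = eps + q by eexists.
rewrite -qE -rE.
have q0 : 0 <= q by rewrite qE sqrtr_ge0.
have q2 : n%:R * q ^+ 2 = ln n%:R.
  by rewrite qE sqr_sqrtr ?divr_ge0 ?ltW// mulrC divfK ?gt_eqF.
have rr : 0 <= r by rewrite rE addr_ge0.
set X := ln n%:R + n%:R * eps ^+ 2.
have X0 : 0 <= X by rewrite addr_ge0 ?mulr_ge0 ?sqr_ge0// ltW.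
have Xn : X <= 2 * n%:R.
  have e2 : eps ^+ 2 <= 1 by nra.
  have := ler_wpM2l (ltW nR) e2; rewrite /X; lra.
have hJR : #|J|%:R <= 4 * n%:R :> R by rewrite -natrM ler_nat.
have [nn0|n0n] := ltnP n n0.
- have r0r : r0 <= r.
    rewrite rE -[leLHS]add0r lerD// qE; apply: ler_wsqrtr; apply: ler_pM.
    + exact: ltW.
    + by rewrite invr_ge0 ltW.
    + by rewrite ler_ln ?posrE// ler_nat.
    + by rewrite lef_pV2 ?posrE// ler_nat ltnW.
  have T0r : T0 <= C1 * r.
    apply: (@le_trans _ _ (T0 / r0 * r)).
      by rewrite mulrAC ler_pdivlMr// ler_wpM2l// ltW.
    by rewrite ler_wpM2r.
  apply: le_trans (some_far_clean e0 e1 n1 hs hY a T0r _) _.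
    have h1 : 16 * n0%:R * gauss_tail T0 <= 1.
      by move: hT0; rewrite ler_pdivlMr ?mulr_gt0// mulrC.
    have h2 : n%:R <= n0%:R :> R by rewrite ler_nat ltnW.
    have h3 : 0 <= gauss_tail T0 by rewrite /gauss_tail fine_ge0.
    by have : #|J|%:R * gauss_tail T0 <= 4 * n0%:R * gauss_tail T0;
      [rewrite ler_wpM2r//; lra|lra].
  rewrite lee_fin; apply: le_trans (expR_ge1Dx _).
  have : (3 / 8) ^+ n0 <= (3 / 8 : R) ^+ n.
    by apply: ler_wiXn2l; [lra|lra|exact: ltnW].
  have : C' * X <= C' * (2 * n0%:R).
    apply: ler_wpM2l; first exact: ltW.
    by apply: (le_trans Xn); rewrite ler_wpM2l// ler_nat ltnW.
  by lra.
- have [rA|rB] := leP (C0 * r) 1.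
  + have tail : gauss_tail (C0 * r) <= 1 / 2 - c * (C0 * r).
      by apply: hc; rewrite rA mulr_ge0// ltW.
    have cC : c * (C0 * r) = 10 / 3 * r by rewrite mulrA /C0 [c * _]mulrC divfK ?gt_eqF.
    have tC1 : C0 * r <= C1 * r by rewrite ler_wpM2r.
    have r20 : 0 <= 2 * r by lra.
    apply: le_trans (some_far_tail (del := 2 * r) e0 e1 n1 hs hY a tC1 r20 _) _.
      have : eps <= r by rewrite rE lerDl.
      by move: tail; rewrite cC; nra.
    rewrite lee_fin.
    (* 2 n (2 r) ^ 2 >= 8 (ln n + n eps ^ 2): four of the ln n pay for the factor
       8 n of the union bound *)
    have e8 : expR (- (2 * n%:R * (2 * r) ^+ 2)) <= expR (- (4 * ln n%:R + X)).
      rewrite ler_expR lerN2 /X.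
      have : n%:R * (eps ^+ 2 + q ^+ 2) <= n%:R * r ^+ 2.
        by apply: (ler_wpM2l (ltW nR)); have := mulr_ge0 e0 q0; rewrite rE; lra.
      rewrite mulrDr q2; have := mulr_ge0 (ltW nR) (sqr_ge0 eps).
      move: (n%:R * eps ^+ 2) => E E0; rewrite (_ : 2 * _ * _ = 8 * (n%:R * r ^+ 2)); last by ring.
      by move: (n%:R * r ^+ 2) => E'; lra.
    apply: (@le_trans _ _ (8 * n%:R * expR (- (4 * ln n%:R + X)))).
      rewrite mulrA; apply: ler_pM => //; rewrite ?expR_ge0 ?mulr_ge0//; lra.
    rewrite opprD expRD mulrA; apply: (@le_trans _ _ (1 * expR (- X))).
      rewrite ler_wpM2r ?expR_ge0// expRN ler_pdivrMr ?expR_gt0// mul1r.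
      rewrite expRM_natl lnK//.
      have : 2 <= n%:R :> R by rewrite (ler_nat _ 2).
      move: (n%:R : R) => x x2; rewrite exprSr; apply: ler_wpM2r; first lra.
      have -> : 8 = 2 ^+ 3 :> R by ring.
      by apply: lerXn2r; rewrite ?nnegrE//; lra.
    rewrite mul1r ler_expR lerN2; nra.
  + have tC1 : t0 <= C1 * r.
      apply: (@le_trans _ _ (t0 * C0 * r)).
        by rewrite -mulrA ler_pMr// ltW.
      by rewrite ler_wpM2r.
    have d0 : 0 <= 1 / 8 :> R by lra.
    apply: le_trans (some_far_tail (del := 1 / 8) e0 e1 n1 hs hY a tC1 d0 _) _.
      by nra.
    rewrite lee_fin.
    have -> : 2 * n%:R * (1 / 8) ^+ 2 = n%:R / 32 :> R by field.
    apply: (@le_trans _ _ (expR (n%:R / 64) * expR (- (n%:R / 32)))).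
      by rewrite mulrA ler_wpM2r ?expR_ge0// (le_trans _ (hn0 _ n0n))//; lra.
    by rewrite -expRD ler_expR; nra.
Qed.

End Concentration.
(** * Deterministic error bounds and rates *)

Section Rates.
Context {R : realType}.

Lemma sqrt2_gt1 : 1 < Num.sqrt 2 :> R.
Proof. by rewrite -{1}(@sqrtr1 R) ltr_sqrt// ltr1n. Qed.

Lemma geometric_sum_le (s : R) (L : nat) : 1 < s ->
  \sum_(l < L.+1) s ^+ l <= s / (s - 1) * s ^+ L.
Proof.
move=> s1; rewrite mulrAC ler_pdivlMr ?subr_gt0// mulrC -subrX1 -exprS.
by rewrite lerBlDr lerDl.
Qed.

Lemma geometric_tail_le (q : R) (m p : nat) : 0 <= q < 1 ->
  \sum_(m <= l < p) q ^+ l <= q ^+ m / (1 - q).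
Proof.
move=> /andP[q0 q1]; rewrite ler_pdivlMr ?subr_gt0//.
have [pm|mp] := leqP p m.
  by rewrite big_geq// mul0r exprn_ge0.
rewrite -{1}[m]add0n big_addn big_mkord.
rewrite (eq_bigr (fun i : 'I_(p - m) => q ^+ m * q ^+ i)); last first.
  by move=> i _; rewrite -exprD addnC.
rewrite -mulr_sumr -mulrA -[leRHS]mulr1 ler_wpM2l ?exprn_ge0//.
rewrite mulrC -opprB mulNr -subrX1 opprB lerBlDr lerDl exprn_ge0//.
Qed.

Lemma coef_bound (l : nat) (beta M t : R) :
  2 `^ (l%:R * (1 / 2 + beta)) * `|t| <= M ->
  `|t| * Num.sqrt 2 ^+ l <= M * (2 `^ (- beta)) ^+ l.
Proof.
have -> : 2 `^ (l%:R * (1 / 2 + beta)) =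
    Num.sqrt 2 ^+ l / (2 `^ (- beta)) ^+ l :> R.
  rewrite mulrC powRrM powRD; last by rewrite pnatr_eq0 implybT.
  rewrite powR_mulrn ?mulr_ge0 ?powR_ge0// exprMn div1r powR12_sqrt//.
  by rewrite powRN exprVn invrK.
have rho0 : 0 < (2 `^ (- beta) : R) ^+ l by rewrite exprn_gt0// powR_gt0.
by rewrite mulrAC ler_pdivrMr// mulrC.
Qed.

(** In the next two lemmas [a] stands for max (ln n / n, eps ^ 2), and
    a ^ (2 beta / (2 beta + 1)) is the squared rate.  The cutoff keeps the
    stochastic error a 2 ^ L below it, and its maximality does the same for the
    squared bias 2 ^ (- 2 beta (L + 1)). *)
Lemma rate_variance (a beta N : R) : 0 < a -> 0 < beta ->
  N <= a `^ (- (1 / (2 * beta + 1))) -> a * N <= a `^ (2 * beta / (2 * beta + 1)).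
Proof.
move=> a0 b0 hN; apply: (@le_trans _ _ (a * a `^ (- (1 / (2 * beta + 1))))).
  by rewrite ler_wpM2l// ltW.
rewrite -{1}(powRr1 (ltW a0)) -powRD; last by rewrite (gt_eqF a0) implybT.
rewrite le_eqVlt; apply/orP; left; apply/eqP; congr (a `^ _); field.
by rewrite gt_eqF//; lra.
Qed.

Lemma rate_bias (a beta : R) (m : nat) : 0 < a -> 0 < beta ->
  a `^ (- (1 / (2 * beta + 1))) < 2 ^+ m ->
  ((2 `^ (- beta)) ^+ m) ^+ 2 <= a `^ (2 * beta / (2 * beta + 1)).
Proof.
move=> a0 b0 hm.
have -> : ((2 `^ (- beta)) ^+ m) ^+ 2 = ((2 ^+ m) `^ (2 * beta))^-1 :> R.
  rewrite -exprM -!powR_mulrn ?powR_ge0// -!powRrM -powRN natrM; congr (_ `^ _).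
  by ring.
have -> : a `^ (2 * beta / (2 * beta + 1)) =
    ((a `^ (- (1 / (2 * beta + 1)))) `^ (2 * beta))^-1.
  rewrite -powRrM -powRN; congr (_ `^ _); field.
  by rewrite gt_eqF//; lra.
rewrite lef_pV2 ?posrE ?powR_gt0 ?exprn_gt0//.
apply: ge0_ler_powR; rewrite ?nnegrE ?powR_ge0 ?exprn_ge0//; [lra|exact: ltW].
Qed.

Lemma rate_max (u e beta : R) : 0 < u -> 0 <= e -> 0 < beta ->
  Num.max (u^-1 `^ (- (2 * beta / (2 * beta + 1)))) (e `^ (4 * beta / (2 * beta + 1)))
  = Num.max u (e ^+ 2) `^ (2 * beta / (2 * beta + 1)).
Proof.
move=> u0 e0 b0; set g := 2 * beta / (2 * beta + 1).
have g0 : 0 < g by rewrite divr_gt0//; lra.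
have -> : u^-1 `^ (- g) = u `^ g.
  by rewrite -powR_inv1 ?ltW// -powRrM mulN1r opprK.
have -> : e `^ (4 * beta / (2 * beta + 1)) = (e ^+ 2) `^ g.
  rewrite -powR_mulrn// -powRrM; congr (_ `^ _); rewrite /g; field.
  by rewrite gt_eqF//; lra.
have mono x y : 0 <= x -> 0 <= y -> x <= y -> x `^ g <= y `^ g.
  by move=> x0 y0; apply: ge0_ler_powR; rewrite ?nnegrE// ltW.
have [h|h] := leP u (e ^+ 2).
  by apply/max_idPr; apply: mono => //; rewrite ?sqr_ge0 ?ltW.
by apply/max_idPl; apply: mono; rewrite ?sqr_ge0// ltW.
Qed.

(** With p the exponent, 2 ^ L <= (n / ln n) ^ p <= n / ln n because
    p <= 1 <= n / ln n, and ln n >= ln 2 >= 1/2. *)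
Lemma cutoff_le (beta eps : R) (n L : nat) : 0 < beta -> (2 <= n)%N ->
  is_cutoff beta eps n L -> (2 ^ L <= 2 * n)%N.
Proof.
move=> b0 n2 [hL _]; have [nR lnn0 lnn] := @ln_nat_bounds R _ n2.
rewrite -(ler_nat R) natrX natrM; apply: (le_trans hL).
set a := Num.max _ _; have ua : ln n%:R / n%:R <= a by rewrite le_max lexx.
have u0 : 0 < ln n%:R / n%:R :> R by rewrite divr_gt0.
have p0 : 0 < 1 / (2 * beta + 1) by rewrite divr_gt0//; lra.
have p1 : 1 / (2 * beta + 1) <= 1 by rewrite ler_pdivrMr; lra.
rewrite powRN.
apply: (@le_trans _ _ ((ln n%:R / n%:R) `^ (1 / (2 * beta + 1)))^-1).
  rewrite lef_pV2 ?posrE ?powR_gt0//; last exact: lt_le_trans ua.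
  by apply: ge0_ler_powR; rewrite ?nnegrE ?(ltW p0)// ?(ltW u0)// (le_trans _ ua) ?(ltW u0).
apply: (@le_trans _ _ (ln n%:R / n%:R)^-1).
  rewrite lef_pV2 ?posrE ?powR_gt0//.
  have ui : 1 <= (ln n%:R / n%:R : R)^-1 by rewrite invf_div ler_pdivlMr// mul1r.
  rewrite -lef_pV2 ?posrE ?invr_gt0 ?powR_gt0//.
  rewrite -powRN -mulN1r powRrM powR_inv1 ?(ltW u0)//.
  exact: ler1_powR.
rewrite invf_div ler_pdivrMr// mulrC mulrA.
have h2 : 1 / 2 <= ln (2 : R).
  rewrite -ler_expR lnK ?posrE//.
  have := expR_ge1Dx (- (1 / 2 : R)); rewrite expRN.
  by rewrite -[(expR _)^-1]div1r ler_pdivlMr ?expR_gt0//; lra.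
have : ln (2 : R) <= ln n%:R by rewrite ler_ln ?posrE// ler_nat.
move=> hn; rewrite -[leLHS]mul1r; apply: (ler_wpM2r (ltW nR)); lra.
Qed.


Lemma card_coordinates_le (L : nat) :
  (#|{: {l : 'I_L.+1 & 'I_(2 ^ l)}}| <= 2 * 2 ^ L)%N.
Proof.
have -> : #|{: {l : 'I_L.+1 & 'I_(2 ^ l)}}| = (\sum_(l < L.+1) \sum_(k < 2 ^ l) 1)%N.
  by rewrite sig_big_dep/= sum1_card.
rewrite (eq_bigr (fun l : 'I_L.+1 => 2 ^ l)%N); last first.
  by move=> l _; rewrite sum1_card card_ord.
elim: L => [|L IH]; first by rewrite big_ord1.
by rewrite big_ord_recr/= (leq_trans (leq_add IH (leqnn _)))// expnS; lia.
Qed.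

Lemma fhatE (psi : widx -> R -> R) (n L : nat) (y : 'I_n -> wseq R) x :
  fhat psi L y x = \sum_(j : {l : 'I_L.+1 & 'I_(2 ^ l)})
    median [seq (y i : widx -> R) (ix (tagged j)) | i <- enum 'I_n] *
    psi (ix (tagged j)) x.
Proof. by rewrite /fhat sig_big_dep. Qed.

Section Deterministic.
Context (psi : widx -> R -> R) (B beta M : R).
Hypotheses (B0 : 0 < B) (beta0 : 0 < beta) (M0 : 0 < M).
Hypothesis hB : forall l x, 0 <= x <= 1 ->
  \sum_(k < 2 ^ l) `|psi (ix k) x| <= B * Num.sqrt 2 ^+ l.

Local Notation rho := (2 `^ (- beta) : R).

Lemma rho_lt1 : 0 <= rho < 1.
Proof.
rewrite powR_ge0/= powRN invf_lt1 ?powR_gt0// -{1}(powRr0 2).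
by rewrite /powR ifF ?pnatr_eq0// ltr_expR ltr_pM2r// ln_gt0// ltr1n.
Qed.

Lemma level_sum_le f l x : wavelet_ball psi beta M f -> 0 <= x <= 1 ->
  `|\sum_(k < 2 ^ l) inner01 f (psi (ix k)) * psi (ix k) x| <= B * M * rho ^+ l.
Proof.
move=> [hf _] x01; rewrite (le_trans (ler_norm_sum _ _ _))//.
have s0 : 0 < Num.sqrt 2 ^+ l :> R by rewrite exprn_gt0// sqrtr_gt0.
apply: (@le_trans _ _ (\sum_(k < 2 ^ l) M * rho ^+ l / Num.sqrt 2 ^+ l * `|psi (ix k) x|)).
  apply: ler_sum => k _; rewrite normrM ler_wpM2r// ler_pdivlMr//.
  exact/coef_bound/hf.
rewrite -mulr_sumr mulrAC ler_pdivrMr//.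
rewrite [B * M]mulrC -!mulrA ler_pM2l// mulrCA ler_wpM2l ?exprn_ge0 ?powR_ge0//.
exact: hB.
Qed.

(** The partial sums beyond [m] stay within the geometric tail of the m-th one,
    and [f x] is their limit. *)
Lemma truncation_error f m x : wavelet_ball psi beta M f -> 0 <= x <= 1 ->
  `|\sum_(l < m) \sum_(k < 2 ^ l) inner01 f (psi (ix k)) * psi (ix k) x - f x|
  <= B * M / (1 - rho) * rho ^+ m.
Proof.
move=> hf x01.
pose g l := \sum_(k < 2 ^ l) inner01 f (psi (ix k)) * psi (ix k) x.
have cf : (fun p => `|\sum_(l < m) g l - \sum_(l < p) g l|) @ \oo -->
    `|\sum_(l < m) g l - f x|.
  by apply: cvg_norm; apply: cvgB; [exact: cvg_cst|exact: hf.2].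
rewrite -(cvg_lim (@Rhausdorff R) cf); apply: limr_le; first by apply/cvg_ex; eexists; exact: cf.
near=> p.
have mp : (m <= p)%N by near: p; exact: nbhs_infty_ge.
rewrite distrC -(big_mkord xpredT g) -(big_mkord xpredT g).
rewrite (big_cat_nat (n := m) (leq0n m) mp)/= addrAC subrr add0r.
rewrite (le_trans (ler_norm_sum _ _ _))//.
apply: (@le_trans _ _ (\sum_(m <= l < p) B * M * rho ^+ l)).
  by apply: ler_sum => l _; exact: level_sum_le.
rewrite -mulr_sumr [leRHS](_ : _ = B * M * (rho ^+ m / (1 - rho))); last by ring.
rewrite ler_wpM2l ?mulr_ge0 ?(ltW B0) ?(ltW M0)//.
exact/geometric_tail_le/rho_lt1.
Unshelve. all: by end_near. Qed.

Lemma estimation_error (v th : widx -> R) (tau : R) L x : 0 <= x <= 1 -> 0 <= tau ->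
  (forall l (k : 'I_(2 ^ l)), (l <= L)%N -> `|v (ix k) - th (ix k)| <= tau) ->
  `|\sum_(l < L.+1) \sum_(k < 2 ^ l) v (ix k) * psi (ix k) x -
    \sum_(l < L.+1) \sum_(k < 2 ^ l) th (ix k) * psi (ix k) x|
  <= B * (Num.sqrt 2 / (Num.sqrt 2 - 1)) * (tau * Num.sqrt 2 ^+ L).
Proof.
move=> x01 tau0 hv; rewrite -sumrB (le_trans (ler_norm_sum _ _ _))//.
apply: (@le_trans _ _ (\sum_(l < L.+1) tau * B * Num.sqrt 2 ^+ l)).
  apply: ler_sum => l _; rewrite -sumrB (le_trans (ler_norm_sum _ _ _))//.
  apply: (@le_trans _ _ (\sum_(k < 2 ^ l) tau * `|psi (ix k) x|)).
    apply: ler_sum => k _; rewrite -mulrBl normrM ler_wpM2r//.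
    by apply: hv; rewrite -ltnS.
  by rewrite -mulr_sumr -mulrA ler_wpM2l// hB.
rewrite -mulr_sumr [leRHS](_ : _ = tau * B *
    (Num.sqrt 2 / (Num.sqrt 2 - 1) * Num.sqrt 2 ^+ L)); last by ring.
by rewrite ler_wpM2l ?mulr_ge0 ?(ltW B0)//; exact/geometric_sum_le/sqrt2_gt1.
Qed.

End Deterministic.
End Rates.
Theorem theorem5p1 (R : realType) (psi : widx -> R -> R)
    (hcdv : cdv_wavelets psi) (honb : orthonormal_basis01 psi)
    (beta M : R) (hbeta : 0 < beta) (hM : 0 < M) :
  exists C C' : R, [/\ 0 < C, 0 < C' &
    forall (eps : R) (n L : nat), 0 <= eps -> eps < 1 / 4 -> (2 <= n)%N ->
    is_cutoff beta eps n L ->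
    forall (f : R -> R) (Pf Q : probability (wseq R) R),
    wavelet_ball psi beta M f -> signal_law psi f Pf ->
    forall (d : measure_display) (T : measurableType d) (P : probability T R)
      (Y : 'I_n -> T -> wseq R),
    iid_sample P (contaminate eps Pf Q) Y ->
    ((1 - expR (- (C' * (ln n%:R + n%:R * eps ^+ 2))))%:E <=
     P [set w | sup01 (fun x => fhat psi L (fun i => Y i w) x - f x)%R ^+ 2 <=
          (C * Num.max ((n%:R / ln n%:R) `^ (- (2 * beta / (2 * beta + 1))))
                       (eps `^ (4 * beta / (2 * beta + 1))))%:E])%E].
Proof.
have [B B0 hB] := cdv_sum_le hcdv honb.
have [C1 [C' [C10 C'0 hmed]]] := @medians_concentrate R.
have s1 := @sqrt2_gt1 R; set s := Num.sqrt 2 in hB s1 *.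
have rho1 := rho_lt1 hbeta; set rho := 2 `^ (- beta) in rho1 *.
pose K1 := B * (s / (s - 1)) * (2 * C1); pose K2 := B * M / (1 - rho).
have K10 : 0 < K1.
  apply: mulr_gt0; last exact: mulr_gt0.
  by apply: mulr_gt0 => //; apply: divr_gt0; [exact: lt_trans s1|rewrite subr_gt0].
have K20 : 0 < K2.
  by apply: divr_gt0; [exact: mulr_gt0|rewrite subr_gt0; case/andP: rho1].
exists ((K1 + K2) ^+ 2), C'; split=> //.
  by rewrite exprn_gt0// addr_gt0.
move=> eps n L e0 e1 n2 hL f Pf Q hf hs d T P Y hY.
have [nR lnn0 lnn] := @ln_nat_bounds R _ n2.
have u0 : 0 < ln n%:R / n%:R :> R by rewrite divr_gt0.
rewrite -[n%:R / ln _]invf_div rate_max//.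
set a := Num.max _ _; set g := _ / _; set V := a `^ g.
have a0 : 0 < a by rewrite /a lt_max u0.
have V0 : 0 <= V by exact: powR_ge0.
set tau := C1 * (eps + Num.sqrt (ln n%:R / n%:R)).
have tau0 : 0 <= tau by rewrite mulr_ge0 ?(ltW C10)// addr_ge0// sqrtr_ge0.
have taua : tau <= 2 * C1 * Num.sqrt a.
  rewrite /tau [2 * C1]mulrC -mulrA (ler_wpM2l (ltW C10))// mulr2n mulrDl !mul1r.
  apply: lerD; last by apply: ler_wsqrtr; rewrite le_max lexx.
  by rewrite -[leLHS]ger0_norm// -sqrtr_sqr ler_wsqrtr// le_max lexx orbT.
have hvar : Num.sqrt a * s ^+ L <= Num.sqrt V.
  rewrite /s -sqrt2X -sqrtrM ?(ltW a0)//; apply: ler_wsqrtr.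
  exact: rate_variance a0 hbeta hL.1.
have hbias : rho ^+ L.+1 <= Num.sqrt V.
  rewrite -[leLHS]ger0_norm ?exprn_ge0 ?powR_ge0// -sqrtr_sqr; apply: ler_wsqrtr.
  apply: rate_bias => //; rewrite ltNge; apply/negP => /hL.2.
  by rewrite ltnn.
pose J := {l : 'I_L.+1 & 'I_(2 ^ l)}.
pose crd (j : J) : widx := ix (tagged j).
have hJ : (#|{: J}| <= 4 * n)%N.
  rewrite (leq_trans (card_coordinates_le L))// (_ : 4 = 2 * 2)%N// -mulnA leq_mul2l/=.
  exact: cutoff_le hL.
have n0 : (0 < n)%N by exact: ltn_trans n2.
have hfar := hmed psi f eps n Pf Q d T P Y e0 e1 n2 hs hY J crd hJ.
have KV0 : 0 <= (K1 + K2) ^+ 2 * V by apply: mulr_ge0 => //; exact: sqr_ge0.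
rewrite (_ : [set w | _] = [set w | forall x, 0 <= x <= 1 ->
    `|\sum_(j : J) med Y (crd j) w * psi (crd j) x - f x| <=
      Num.sqrt ((K1 + K2) ^+ 2 * V)]); last first.
  apply/seteqP; split=> w /=; rewrite sup01_sqr_le//.
    by move=> h x /h; rewrite fhatE.
  by move=> h x /h; rewrite fhatE.
have mE : measurable [set w | forall x, 0 <= x <= 1 ->
    `|\sum_(j : J) med Y (crd j) w * psi (crd j) x - f x| <=
      Num.sqrt ((K1 + K2) ^+ 2 * V)].
  apply: (@measurable_forall_affine R d T J R [set x | 0 <= x <= 1]
    (fun j => med Y (crd j)) (fun x j => psi (crd j) x) f) => j.
  exact: measurable_med hY _.
have mfar := measurable_some_far psi f hY crd tau.
(* the uniform closeness of the medians implies the bound on the error *)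
apply: (@le_trans _ _ (P (~` some_far psi f Y crd tau))).
  by rewrite probability_setC// EFinB leeB.
apply: le_measure; rewrite ?inE//; first exact: measurableC.
move=> w /= hw x x01.
have hclose l (k : 'I_(2 ^ l)) : (l <= L)%N ->
    `|med Y (ix k) w - inner01 f (psi (ix k))| <= tau.
  move=> lL; rewrite leNgt; apply/negP => hk; apply: hw.
  by exists (Tagged (fun l : 'I_L.+1 => 'I_(2 ^ l)) (k : 'I_(2 ^ (Ordinal (lL : (l < L.+1)%N))))).
rewrite sqrtrM ?sqr_ge0// sqrtr_sqr [`|K1 + K2|]ger0_norm; last first.
  by rewrite addr_ge0 ?(ltW K10) ?(ltW K20).
have est := @estimation_error R psi B B0 hB (med Y ^~ w)
  (fun b => inner01 f (psi b)) tau L x x01 tau0 hclose.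
have tru := truncation_error B0 hbeta hM hB L.+1 hf x01.
have -> : \sum_(j : J) med Y (crd j) w * psi (crd j) x =
    \sum_(l < L.+1) \sum_(k < 2 ^ l) med Y (ix k) w * psi (ix k) x.
  by rewrite sig_big_dep.
rewrite -[X in `|X|](subrKA (\sum_(l < L.+1) \sum_(k < 2 ^ l)
  inner01 f (psi (ix k)) * psi (ix k) x)).
rewrite (le_trans (ler_normD _ _))// mulrDl lerD//.
  apply: (le_trans est).
  rewrite [leRHS](_ : _ = B * (s / (s - 1)) * (2 * C1 * Num.sqrt V)); last first.
    by rewrite /K1 !mulrA.
  apply: ler_wpM2l.
    by rewrite mulr_ge0 ?(ltW B0)// divr_ge0 ?sqrtr_ge0// subr_ge0 ltW.
  apply: (@le_trans _ _ (2 * C1 * Num.sqrt a * s ^+ L)).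
    by rewrite ler_wpM2r// exprn_ge0// sqrtr_ge0.
  by rewrite -mulrA ler_wpM2l// mulr_ge0// ltW.
by apply: (le_trans tru); rewrite ler_wpM2l// ltW.
Qed.
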